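(* Let $f$ be a non-constant entire function of order $\rho<1$. Then for every $z\in\mathbb{C}$, the convergence exponent of the sequence $\{\phi_{0n}(z)\}_n$ equals $\rho$. In addition, if $\rho\ne 0$, then $f$ is of maximal, minimal, or normal type according as the upper density $$\triangle(\{\phi_{0n}(z)\}_n)=\limsup_{r\to\infty}\frac{n_{\{\phi_{0n}(z)\}_n}(r)}{r^{\rho}}$$ of the orbit of any $z\in\mathbb{C}$ equals infinity, zero, or a number different from zero and infinity. In particular, this upper density is independent of $z$.
   Context: ${\rm Aut}(f)=\{\phi_{0n}\}_n$ denotes the automorphic functions of $f$ (branches of $f^{-1}\circ f$); for fixed $z$, the orbit $\{\phi_{0n}(z)\}_n$ is the set of zeros of $w\mapsto f(w)-f(z)$ listed with multiplicity, and $n_{\{\phi_{0n}(z)\}_n}(r)=|\{n:|\phi_{0n}(z)|<r\}|$. Convergence exponent of $\{a_n\}$: $\inf\{\lambda>0:\sum_{a_n\ne0}|a_n|^{-\lambda}<\infty\}$. With $M_f(r)=\max_{|w|=r}|f(w)|$ and type $\sigma=\limsup_{r\to\infty}\log M_f(r)/r^\rho$, $f$ is of maximal type if $\sigma=\infty$, minimal type if $\sigma=0$, normal type if $0<\sigma<\infty$.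
   Formalization: The final clause is proved as: whether the upper density is infinite, zero, or finite and nonzero does not depend on z; its exact value can depend on z (e.g. the product of (1+w/n^{1/ρ}) with 1/2<ρ<1 has density 1 at its zeros but at least 1/sin(πρ) elsewhere). *)

(* Defs.v *)
From HB Require Import structures.
From mathcomp Require Import all_boot all_order all_algebra.
From mathcomp Require Import all_classical all_reals all_analysis.
From mathcomp Require Import complex.
Import Order.TTheory GRing.Theory Num.Theory.
Import numFieldNormedType.Exports.

Set Implicit Arguments.
Unset Strict Implicit.
Unset Printing Implicit Defensive.

Local Open Scope ring_scope.
Local Open Scope classical_set_scope.

Section Defs.
Variable R : realType.
Local Notation C := R[i].

Definition cmod (z : C) : R := Normc.normc z.

Definition entire (f : C -> C) : Prop :=
  exists a : nat -> C, forall (z : C) (e : R), 0 < e ->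
    exists N : nat, forall n : nat, (N <= n)%N ->
      cmod (f z - \sum_(k < n) a k * z ^+ k) < e.

Definition zero_order (g : C -> C) (w : C) (m : nat) : Prop :=
  exists h : C -> C, [/\ entire h, h w != 0 & forall u, g u = (u - w) ^+ m * h u].

Definition mult (g : C -> C) (w : C) : nat := xget 0%N [set m | zero_order g w m].

(* the orbit {phi_0n(z)}_n : zeros of w |-> f w - f z (as a set; multiplicities
   are accounted for with [mult]) *)
Definition orbit_fun (f : C -> C) (z : C) : C -> C := fun w => f w - f z.
Definition orbit_set (f : C -> C) (z : C) : set C := [set w | orbit_fun f z w = 0].

Definition orbit_count (f : C -> C) (z : C) (r : R) : \bar R :=
  (\esum_(w in [set w | orbit_set f z w /\ (cmod w < r)%R]) ((mult (orbit_fun f z) w)%:R)%:E)%E.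

Definition conv_exponent (f : C -> C) (z : C) : \bar R :=
  ereal_inf [set (lam%:E)%E | lam in
    [set lam : R | 0 < lam /\
       (\esum_(w in [set w | orbit_set f z w /\ (w != 0)%R])
          ((mult (orbit_fun f z) w)%:R * (cmod w) `^ (- lam))%:E < +oo)%E]].

Definition max_mod (f : C -> C) (r : R) : R :=
  sup [set cmod (f w) | w in [set w | cmod w = r]].

Definition forder (f : C -> C) : \bar R :=
  limf_esup (fun r : R => (ln (ln (max_mod f r)) / ln r)%:E) +oo.

Definition ftype (f : C -> C) (rho : R) : \bar R :=
  limf_esup (fun r : R => (ln (max_mod f r) / r `^ rho)%:E) +oo.

Definition upper_density (f : C -> C) (z : C) (rho : R) : \bar R :=
  limf_esup (fun r : R => (orbit_count f z r * ((r `^ rho)^-1)%:E)%E) +oo.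

End Defs.

(* Main.v *)
Require Import Defs.
From HB Require Import structures.
From mathcomp Require Import all_boot all_order all_algebra all_solvable all_field.
From mathcomp Require Import all_classical all_reals all_analysis.
From mathcomp Require Import complex.
From mathcomp Require Import ring lra zify.
Import Order.TTheory GRing.Theory Num.Theory.
Import numFieldNormedType.Exports.
Set Implicit Arguments.
Unset Strict Implicit.
Unset Printing Implicit Defensive.
Local Open Scope ring_scope.
Local Open Scope classical_set_scope.

(** Write f(u) - f(z) = u^m h(u) with h(0) != 0, and let n(r) count the zeros a
    of h with |a| < r. Dividing these zeros out of h and bounding the quotient
    at 0 by its values on |u| = 3r gives 2^n(r) |h(0)| <= max_(|u| = 3r) |h|, so n is
    controlled by the maximum modulus.
    Conversely, on |u| < r the zero-free cofactor p of h satisfies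
    log |p| <= log M(3r) + O(1) = o(r), because the order is less than 1; the
    Borel-Caratheodory inequality for log p then forces |p(w)/p(0)| -> 1 for
    fixed w as r grows, whence |h(w)| <= |h(0)| prod_a (1 + |w|/|a|).
    Both estimates combined with dyadic summation over the zeros compare
    log M(r), n(r) and sum_a |a|^-lambda. Logarithms are avoided on p itself:
    p is approximated by its Taylor polynomials, whose finitely many roots lie
    outside the disk, and circle means are finite means over roots of unity. *)

(** The type and the upper density are only compared up to multiplicative constants; this is why the
    conclusion is a trichotomy (zero, finite and positive, infinite) and not an identity between the
    two quantities. The base point z enters through m, |f(z)| and the function h, and contributes
    terms that are of lower order than r^rho. Two base points are therefore never compared with each
    other: each orbit is compared with the type, in which z does not occur.

    No infinite product is formed. At every radius the zeros form a finite list, and it is enough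
    that the sums and products over these lists are bounded independently of the radius. Besides
    making the cofactor's exponent o(r), the condition rho < 1 makes the zeros beyond r harmless:
    there ln(1 + r/|a|) <= r/|a|, and the sum of r/|a| is again of size r^rho. *)

(** * The real-valued modulus on the complex numbers, and geometric sums *)

Section Modulus.
Variable R : realType.
Local Notation C := R[i].
Implicit Types (z w u : C) (r : R).

Lemma cmodE z : ((cmod z)%:C)%C = `|z|.
Proof. by case: z. Qed.

Lemma cmod_ge0 z : 0 <= cmod z.
Proof. by case: z => x y; rewrite sqrtr_ge0. Qed.

Lemma cmod0 : cmod (0 : C) = 0. Proof. exact: Normc.normc0. Qed.
Lemma cmod1 : cmod (1 : C) = 1. Proof. exact: Normc.normc1. Qed.
Lemma cmodM z w : cmod (z * w) = cmod z * cmod w. Proof. exact: Normc.normcM. Qed.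
Lemma cmodV z : cmod z^-1 = (cmod z)^-1. Proof. exact: Normc.normcV. Qed.
Lemma cmodN z : cmod (- z) = cmod z. Proof. exact: normcN. Qed.
Lemma cmodD z w : cmod (z + w) <= cmod z + cmod w. Proof. exact: le_normcD. Qed.
Lemma cmodB z w : cmod (z - w) <= cmod z + cmod w.
Proof. by rewrite (le_trans (cmodD _ _))// cmodN. Qed.
Lemma cmodBC z w : cmod (z - w) = cmod (w - z).
Proof. by rewrite -cmodN opprB. Qed.

Lemma cmod_eq0 z : (cmod z == 0) = (z == 0).
Proof.
apply/eqP/eqP => [/Normc.eq0_normc//|->]; exact: cmod0.
Qed.

Lemma cmod_gt0 z : (0 < cmod z) = (z != 0).
Proof. by rewrite lt_def cmod_ge0 cmod_eq0 andbT. Qed.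

Lemma cmod_real r : cmod (r%:C)%C = `|r|.
Proof. by rewrite /cmod/= expr0n/= addr0 sqrtr_sqr. Qed.

Lemma cmod_nat n : cmod (n%:R : C) = n%:R.
Proof.
by rewrite -(rmorph_nat (real_complex R)) cmod_real ger0_norm.
Qed.

Lemma cmodX z n : cmod (z ^+ n) = cmod z ^+ n.
Proof. by elim: n => [|n IH]; rewrite ?expr0 ?cmod1// !exprS cmodM IH. Qed.

Lemma cmodB_ge z w : cmod z - cmod w <= cmod (z - w).
Proof. by have := cmodD (z - w) w; rewrite subrK; lra. Qed.

Lemma cmod_prod (I : Type) (s : seq I) (F : I -> C) :
  cmod (\prod_(i <- s) F i) = \prod_(i <- s) cmod (F i).
Proof. by elim/big_rec2 : _ => [|i x y _ <-]; rewrite ?cmod1 ?cmodM. Qed.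

Lemma cmod_sum (I : Type) (s : seq I) (F : I -> C) :
  cmod (\sum_(i <- s) F i) <= \sum_(i <- s) cmod (F i).
Proof.
elim/big_rec2 : _ => [|i x y _ h]; rewrite ?cmod0//.
by rewrite (le_trans (cmodD _ _))// lerD2l.
Qed.

Lemma Re_le_cmod z : complex.Re z <= cmod z.
Proof.
case: z => x y /=; rewrite (le_trans (ler_norm x))// -sqrtr_sqr ler_wsqrtr//.
by rewrite lerDl sqr_ge0.
Qed.

Lemma normRe_le_cmod z : `|complex.Re z| <= cmod z.
Proof.
case: z => x y /=; rewrite -sqrtr_sqr ler_wsqrtr//.
by rewrite lerDl sqr_ge0.
Qed.

Lemma normIm_le_cmod z : `|complex.Im z| <= cmod z.
Proof.
case: z => x y /=; rewrite -sqrtr_sqr ler_wsqrtr//.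
by rewrite lerDr sqr_ge0.
Qed.

Lemma cmod_le_ReIm z : cmod z <= `|complex.Re z| + `|complex.Im z|.
Proof.
case: z => x y /=; rewrite -(ger0_norm (addr_ge0 (normr_ge0 x) (normr_ge0 y))).
rewrite -sqrtr_sqr ler_wsqrtr// -(real_normK (num_real x)) -(real_normK (num_real y)).
by have := mulr_ge0 (normr_ge0 x) (normr_ge0 y); nra.
Qed.

Lemma ReB z w : complex.Re (z - w) = complex.Re z - complex.Re w.
Proof. by case: z; case: w. Qed.

Lemma ImB z w : complex.Im (z - w) = complex.Im z - complex.Im w.
Proof. by case: z; case: w. Qed.

Lemma Re_sum (I : Type) (s : seq I) (F : I -> C) :
  complex.Re (\sum_(i <- s) F i) = \sum_(i <- s) complex.Re (F i).
Proof. by elim/big_rec2 : _ => // i x y _ <-; case: (F i); case: y. Qed.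

Lemma Im_sum (I : Type) (s : seq I) (F : I -> C) :
  complex.Im (\sum_(i <- s) F i) = \sum_(i <- s) complex.Im (F i).
Proof. by elim/big_rec2 : _ => // i x y _ <-; case: (F i); case: y. Qed.

Lemma Re_scale r z : complex.Re ((r%:C)%C * z) = r * complex.Re z.
Proof. by case: z => x y /=; rewrite mul0r subr0. Qed.

Lemma le_of_eps (x y : R) : (forall e, 0 < e -> x <= y + e) -> x <= y.
Proof. by move=> h; apply/ler_addgt0Pr. Qed.

Lemma cmod_small_eq0 z : (forall e, 0 < e -> cmod z <= e) -> z = 0.
Proof.
move=> h; apply/eqP; rewrite -cmod_eq0 eq_le cmod_ge0 andbT.
by apply: le_of_eps => e e0; rewrite add0r h.
Qed.

Lemma exp_small (q : R) (e c : R) : 0 <= q < 1 -> 0 < e -> 0 <= c ->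
  exists N, forall n, (N <= n)%N -> c * q ^+ n < e.
Proof.
move=> /andP[q0 q1] e0 c0.
have := @cvg_geometric R c q; rewrite ger0_norm// => /(_ q1)/cvgrPdist_lt/(_ e e0).
move=> [N _ hN]; exists N => n Nn; have := hN n Nn.
rewrite /geometric/= sub0r normrN ger0_norm//.
by rewrite mulr_ge0// exprn_ge0.
Qed.

Lemma geom_tail_le (q : R) n m : 0 <= q <= 2^-1 ->
  \sum_(n <= k < m) q ^+ k <= 2 * q ^+ n.
Proof.
move=> /andP[q0 q1].
have [nm|/ltnW mn] := leqP n m; last by rewrite big_geq// mulr_ge0// exprn_ge0.
have -> : m = (n + (m - n))%N by rewrite subnKC.
move: (m - n)%N => d.
(* The subtracted term is what makes the induction close: a new summand q^(n+d) is paid for by 2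
   q^(n+d+1) <= q^(n+d), that is, by q <= 1/2. *)
have h : \sum_(n <= k < n + d) q ^+ k <= 2 * q ^+ n - 2 * q ^+ (n + d).
  elim: d => [|d IH]; first by rewrite addn0 big_geq// subrr.
  rewrite addnS big_nat_recr ?leq_addr//=.
  have := exprn_ge0 (n + d) q0; rewrite exprS; nra.
apply: (le_trans h); rewrite gerBl mulr_ge0// exprn_ge0//.
Qed.

End Modulus.

(** * Entire functions as everywhere convergent power series *)

Section PowerSeries.
Variable R : realType.
Local Notation C := R[i].
Implicit Types (a b : nat -> C) (f g h q : C -> C) (z w u : C).

Definition psum a n z : C := \sum_(k < n) a k * z ^+ k.

Definition pser a f := forall z (e : R), 0 < e ->
  exists N : nat, forall n : nat, (N <= n)%N -> cmod (f z - psum a n z) < e.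

(** Infinite radius of convergence, stated without a limit superior. [pser_growth] and [growth_pser]
    show that it characterizes the coefficient sequences of entire functions. *)
Definition growth a := forall r : R, 0 < r ->
  exists2 B : R, 0 <= B & forall k, cmod (a k) * r ^+ k <= B.

Lemma psumS a n z : psum a n.+1 z = psum a n z + a n * z ^+ n.
Proof. by rewrite /psum big_ord_recr. Qed.

Lemma pser_growth a f : pser a f -> growth a.
Proof.
move=> af r r0.
have [N hN] := af (r%:C)%C 1 ltr01.
have Sge0 : 0 <= \sum_(k < N) cmod (a k) * r ^+ k.
  by apply: sumr_ge0 => i _; rewrite mulr_ge0 ?cmod_ge0// exprn_ge0// ltW.
exists (2 + \sum_(k < N) cmod (a k) * r ^+ k); first by rewrite addr_ge0.
move=> k; have [kN|Nk] := ltnP k N.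
  rewrite (bigD1 (Ordinal kN))//= addrCA lerDl addr_ge0//.
  by apply: sumr_ge0 => i _; rewrite mulr_ge0 ?cmod_ge0// exprn_ge0// ltW.
rewrite ler_wpDr//.
(* From N on, a term of the series at the point r is a difference of two consecutive errors, each
   below 1. *)
have := hN k Nk; have := hN k.+1 (leqW Nk).
set x := f _ - _ => hx; set y := f _ - _ => hy.
have -> : cmod (a k) * r ^+ k = cmod (y - x).
  rewrite -[r in LHS]ger0_norm ?ltW// -cmod_real -cmodX -cmodM; congr cmod.
  by rewrite /x /y psumS; ring.
by rewrite (le_trans (cmodB _ _))//; lra.
Qed.

Lemma pser0 a f : pser a f -> f 0 = a 0%N.
Proof.
move=> af; apply/eqP; rewrite -subr_eq0; apply/eqP/cmod_small_eq0 => e e0.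
have [N /(_ N.+1 (leqnSn _))] := af 0 e e0.
rewrite /psum big_ord_recl big1 ?addr0 ?expr0 ?mulr1; first exact: ltW.
by move=> i _; rewrite expr0n/= mulr0.
Qed.

Lemma psum_tail a (r B q : R) z n m :
  (forall k, cmod (a k) * r ^+ k <= B) -> 0 <= q <= 2^-1 ->
  cmod z <= q * r -> (n <= m)%N ->
  cmod (psum a m z - psum a n z) <= 2 * B * q ^+ n.
Proof.
move=> hB q01 zr nm.
have B0 : 0 <= B by apply: le_trans (hB 0%N); rewrite expr0 mulr1 cmod_ge0.
have -> : psum a m z - psum a n z = \sum_(n <= k < m) a k * z ^+ k.
  rewrite /psum -!(big_mkord xpredT (fun k => a k * z ^+ k)).
  by rewrite (big_cat_nat _ nm)//= addrAC subrr add0r.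
apply: (le_trans (cmod_sum _ _)).
apply: (@le_trans _ _ (B * \sum_(n <= k < m) q ^+ k)).
  rewrite mulr_sumr; apply: ler_sum => k _.
  rewrite cmodM cmodX (@le_trans _ _ (cmod (a k) * (q * r) ^+ k))//.
    by rewrite ler_wpM2l ?cmod_ge0// lerXn2r// ?nnegrE ?cmod_ge0// (le_trans (cmod_ge0 z)).
  rewrite exprMn mulrCA mulrC ler_wpM2r// exprn_ge0//; by case/andP: q01.
by rewrite -mulrA mulrCA ler_wpM2l// geom_tail_le.
Qed.

Lemma pser_tail a f (r B q : R) z n : pser a f ->
  (forall k, cmod (a k) * r ^+ k <= B) -> 0 <= q <= 2^-1 ->
  cmod z <= q * r ->
  cmod (f z - psum a n z) <= 2 * B * q ^+ n.
Proof.
move=> af hB q01 zr; apply: le_of_eps => e e0.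
have [N hN] := af z e e0.
pose m := maxn N n.
have -> : f z - psum a n z = (f z - psum a m z) + (psum a m z - psum a n z) by ring.
rewrite (le_trans (cmodD _ _))// addrC lerD//.
  by apply: psum_tail zr _ => //; rewrite leq_maxr.
by apply/ltW/hN; rewrite leq_maxl.
Qed.

Lemma pser_unif a f (r : R) : pser a f -> 0 < r ->
  exists2 B : R, 0 <= B & forall z n, cmod z <= r ->
    cmod (f z - psum a n z) <= B * 2^-1 ^+ n.
Proof.
(* Bounding the coefficients at radius 2r makes the ratio on the disk of radius r equal to 1/2. *)
move=> af r0; have r20 : 0 < 2 * r by lra.
have [B B0 hB] := pser_growth af r20.
exists (2 * B); first by lra.
by move=> z n zr; apply: (pser_tail n af hB); lra.
Qed.

Lemma entire_bounded f (r : R) : entire f ->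
  exists2 B : R, 0 <= B & forall z, cmod z <= r -> cmod (f z) <= B.
Proof.
move=> [a af]; have r0 : 0 < `|r| + 1 by rewrite ltr_wpDl.
have [B B0 hB] := pser_unif af r0.
exists B => // z zr; have := hB z 0%N; rewrite /psum big_ord0 subr0 expr0 mulr1.
by apply; have := ler_norm r; lra.
Qed.

Lemma real_series_lim (u : nat -> R) (B : R) :
  (forall n, \sum_(k < n) `|u k| <= B) ->
  exists l, forall e, 0 < e -> exists N, forall n, (N <= n)%N ->
    `|l - \sum_(k < n) u k| < e.
Proof.
move=> hB.
have : cvgn (series u).
  apply: normed_cvg; apply: nondecreasing_is_cvgn.
    by apply: nondecreasing_series => n _ _; rewrite /= normr_ge0.
  exists B => _ [n _ <-]; have := hB n; by rewrite -(big_mkord xpredT (fun k => `|u k|)).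
move=> /cvg_ex[l /cvgrPdist_lt hl]; exists l => e e0.
have [N _ hN] := hl e e0; exists N => n Nn.
by have := hN n Nn; rewrite /series/= big_mkord.
Qed.

Lemma growth_pser a : growth a -> exists f, pser a f.
Proof.
move=> ga.
suff H z : exists l : C, forall e, 0 < e -> exists N, forall n, (N <= n)%N ->
    cmod (l - psum a n z) < e.
  by exists (fun z => sval (cid (H z))) => z e e0; case: cid => l /= /(_ e e0).
(* At this radius the terms at z are dominated by B 2^-k; the added 1 keeps the radius positive when
   z = 0. *)
have r0 : 0 < 2 * (cmod z + 1) by have := cmod_ge0 z; lra.
have [B B0 hB] := ga _ r0.
have hS n : \sum_(k < n) cmod (a k * z ^+ k) <= 2 * B.
  apply: (@le_trans _ _ (B * \sum_(0 <= k < n) 2^-1 ^+ k)).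
    rewrite big_mkord mulr_sumr; apply: ler_sum => k _.
    rewrite cmodM cmodX (@le_trans _ _ (cmod (a k) * (2^-1 * (2 * (cmod z + 1))) ^+ k))//.
      rewrite ler_wpM2l ?cmod_ge0// lerXn2r// ?nnegrE ?cmod_ge0//; last by lra.
      by have := cmod_ge0 z; lra.
    by rewrite exprMn mulrCA mulrC ler_wpM2r// exprn_ge0.
  by rewrite mulrC ler_wpM2r// (le_trans (geom_tail_le _ _ _))// ?expr0 ?mulr1//; lra.
have [|x hx] := @real_series_lim (fun k => complex.Re (a k * z ^+ k)) (2 * B).
  move=> n; apply: le_trans (hS n); apply: ler_sum => k _; exact: normRe_le_cmod.
have [|y hy] := @real_series_lim (fun k => complex.Im (a k * z ^+ k)) (2 * B).
  move=> n; apply: le_trans (hS n); apply: ler_sum => k _; exact: normIm_le_cmod.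
exists (Complex x y) => e e0; have e20 : 0 < e / 2 by lra.
have [N hN] := hx _ e20; have [M hM] := hy _ e20.
exists (maxn N M) => n; rewrite geq_max => /andP[Nn Mn].
rewrite (le_lt_trans (cmod_le_ReIm _))// ReB ImB /= Re_sum Im_sum.
by have := hN n Nn; have := hM n Mn; lra.
Qed.

Lemma entire_subC f (c : C) : entire f -> entire (fun u => f u - c).
Proof.
move=> [a af].
exists (fun k => if k is 0%N then a 0%N - c else a k) => z e e0.
have [N hN] := af z e e0; exists N.+1 => -[//|n] Nn.
have -> : f z - c - \sum_(k < n.+1) (if nat_of_ord k is 0%N then a 0%N - c else a k) * z ^+ k
   = f z - psum a n.+1 z.
  by rewrite /psum !big_ord_recl/= expr0; ring.
by apply: hN; rewrite ltnW.
Qed.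

Lemma entire_mulXB q w : entire q -> entire (fun u => (u - w) * q u).
Proof.
move=> [a aq].
exists (fun k => if k is j.+1 then a j - w * a k else - w * a 0%N) => z e e0.
have cz : 0 < cmod z + cmod w + 1 by have := cmod_ge0 z; have := cmod_ge0 w; lra.
pose e' := e / 2 / (cmod z + cmod w + 1).
have e'0 : 0 < e' by rewrite !divr_gt0.
have [N hN] := aq z e' e'0.
exists N.+1 => -[//|n] Nn.
have -> : \sum_(k < n.+1) (if nat_of_ord k is j.+1 then a j - w * a k else - w * a 0%N) * z ^+ k
   = z * psum a n z - w * psum a n.+1 z.
  elim: n {Nn} => [|n IH].
    by rewrite /psum big_ord0 !big_ord_recl !big_ord0/= expr0; ring.
  by rewrite big_ord_recr/= IH (psumS a n.+1) (psumS a n) exprS; ring.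
have -> : (z - w) * q z - (z * psum a n z - w * psum a n.+1 z) =
  z * (q z - psum a n z) - w * (q z - psum a n.+1 z) by ring.
apply: (le_lt_trans (cmodB _ _)); rewrite !cmodM.
have h1 := hN n Nn; have h2 := hN n.+1 (leqW Nn).
have : (cmod z + cmod w + 1) * e' = e / 2 by rewrite /e' mulrC divfK// gt_eqF.
have := ler_wpM2l (cmod_ge0 z) (ltW h1); have := ler_wpM2l (cmod_ge0 w) (ltW h2).
nra.
Qed.

(* If f(u) - f(w) = (u - w) q(u), the coefficients of q satisfy
   -w b_0 = a_0 - f(w) and b_{j-1} - w b_j = a_j; solving this recursion
   exhibits b_j as a tail of the series of f at w. *)
Lemma entire_quotient f w : entire f ->
  exists2 q, entire q & forall u, f u - f w = (u - w) * q u.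
Proof.
move=> [a af].
pose b j := if w == 0 then a j.+1 else (f w - psum a j.+1 w) / w ^+ j.+1.
(* Long division of the truncated series by u - w: the only remainder is one top-degree term, which
   tends to 0 with n because b has infinite radius of convergence. *)
have bs n u : f w + (u - w) * psum b n u = psum a n u + (if n is m.+1 then b m * u ^+ n else f w).
  elim: n => [|n IH]; first by rewrite /psum !big_ord0; ring.
  rewrite !psumS mulrDr addrA IH; case: n {IH} => [|n].
    rewrite /psum big_ord0 !expr0 /b; case: eqVneq => [->|w0].
      by rewrite (pser0 af); ring.
    by rewrite /psum big_ord_recl big_ord0 expr0; field.
  suff -> : b n = a n.+1 + w * b n.+1 by rewrite !exprS; ring.
  rewrite /b; case: eqVneq => [->|w0]; first by rewrite mul0r addr0.
  by rewrite (psumS _ n.+1) !exprS; field; rewrite w0 expf_neq0.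
have gb : growth b.
  move=> r r0; rewrite /b; case: eqVneq => [w0|w0].
    have [B B0 hB] := pser_growth af r0; exists (B / r); first by rewrite divr_ge0// ltW.
    by move=> k; rewrite ler_pdivlMr// -mulrA -exprSr.
  (* Chosen so that |w|/r' <= 1/2, as the tail estimate requires, and r/r' <= 1, so that the bound
     on b_k r^k does not grow with k. *)
  pose r' := 2 * (r + cmod w).
  have w0' : 0 < cmod w by rewrite cmod_gt0.
  have r'0 : 0 < r' by rewrite /r'; lra.
  have [B B0 hB] := pser_growth af r'0; exists (2 * B / r); first by rewrite divr_ge0//; lra.
  move=> k; rewrite ler_pdivlMr// -mulrA -exprSr cmodM cmodV cmodX.
  have hq : 0 <= cmod w / r' <= 2^-1.
    apply/andP; split; first by rewrite divr_ge0// ltW.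
    by rewrite ler_pdivrMr// /r'; lra.
  have wr : cmod w <= cmod w / r' * r' by rewrite divfK// gt_eqF.
  have := pser_tail k.+1 af hB hq wr.
  move=> h; rewrite -mulrA -exprVn -exprMn.
  apply: (@le_trans _ _ (2 * B * (cmod w / r') ^+ k.+1 * ((cmod w)^-1 * r) ^+ k.+1)).
    by rewrite ler_wpM2r// exprn_ge0// mulr_ge0 ?invr_ge0 ?ltW.
  rewrite -mulrA -exprMn -[leRHS]mulr1 ler_wpM2l//; first by lra.
  rewrite exprn_ile1//; first by rewrite !mulr_ge0 ?invr_ge0 ?ltW.
  have -> : cmod w / r' * ((cmod w)^-1 * r) = r / r' by field; rewrite !gt_eqF.
  by rewrite ler_pdivrMr// /r'; lra.
have [q bq] := growth_pser gb; exists q; first by exists b.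
move=> u; apply/eqP; rewrite -subr_eq0; apply/eqP/cmod_small_eq0 => e e0.
have u0 := cmod_ge0 u.
have r0 : 0 < 2 * (cmod u + 1) by lra.
have [B B0 hB] := gb _ r0.
pose c := cmod (u - w) + 1; have c0 : 0 < c by rewrite /c; have := cmod_ge0 (u - w); lra.
have e30 : 0 < e / 3 by lra.
have ec0 : 0 < e / 3 / c by rewrite divr_gt0.
have [N1 h1] := af u _ e30; have [N2 h2] := bq u _ ec0.
have cB : 0 <= cmod u * B by rewrite mulr_ge0.
have hh : 0 <= (2^-1 : R) < 1 by lra.
have [N3 h3] := exp_small hh e30 cB.
pose n := (N1 + N2 + N3)%N.
have -> : f u - f w - (u - w) * q u =
  (f u - psum a n.+1 u) - (u - w) * (q u - psum b n.+1 u) - b n * u ^+ n.+1.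
  have := bs n.+1 u => /= E.
  have -> : psum a n.+1 u = f w + (u - w) * psum b n.+1 u - b n * u ^+ n.+1 by rewrite E; ring.
  by ring.
apply: (le_trans (cmodB _ _)); apply: (@le_trans _ _ (e / 3 + e / 3 + e / 3)); last by lra.
apply: lerD; last first.
  rewrite exprS mulrCA cmodM cmodM cmodX.
  apply: le_trans (ltW (h3 n _)); last by rewrite /n; lia.
  rewrite -mulrA ler_wpM2l//.
  apply: (@le_trans _ _ (cmod (b n) * (2^-1 * (2 * (cmod u + 1))) ^+ n)).
    rewrite ler_wpM2l ?cmod_ge0// lerXn2r// ?nnegrE; lra.
  by rewrite exprMn mulrCA mulrC ler_wpM2r// exprn_ge0//; lra.
apply: (le_trans (cmodB _ _)); apply: lerD.
  by apply/ltW/h1; rewrite /n; lia.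
rewrite cmodM; have /ltW h : cmod (q u - psum b n.+1 u) < e / 3 / c by apply: h2; rewrite /n; lia.
have : c * (e / 3 / c) = e / 3 by rewrite mulrC divfK// gt_eqF.
have := cmod_ge0 (u - w); rewrite /c in h *; move: h; set x := cmod (q u - _); set y := cmod (u - w).
by have := cmod_ge0 (q u - psum b n.+1 u); rewrite -/x; nra.
Qed.

(** m is the index of the first nonzero coefficient and h is the series shifted by m. *)
Lemma entire_factor0 g : entire g -> (exists u, g u != 0) ->
  exists m h, [/\ entire h, h 0 != 0 & forall u, g u = u ^+ m * h u].
Proof.
move=> [a ag] [u0 gu0].
have ex : exists k, a k != 0.
  apply/not_existsP => H; move/eqP: gu0; apply; apply: cmod_small_eq0 => e e0.
  have [N /(_ N (leqnn _))] := ag u0 e e0.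
  rewrite /psum big1 ?subr0; first exact: ltW.
  by move=> i _; have := H i => /negP; rewrite negbK => /eqP ->; rewrite mul0r.
pose m := ex_minn ex.
have [am0 mmin] : a m != 0 /\ forall k, (k < m)%N -> a k = 0.
  rewrite /m; case: ex_minnP => k ak kmin; split=> // j jk; apply/eqP.
  by apply: contraTT jk => /kmin; rewrite -leqNgt.
pose b k := a (m + k)%N.
have gb : growth b.
  move=> r r0; have [B B0 hB] := pser_growth ag r0.
  exists (B / r ^+ m); first by rewrite divr_ge0// exprn_ge0// ltW.
  move=> k; rewrite ler_pdivlMr ?exprn_gt0// -mulrA -exprD addnC; exact: hB.
have [h bh] := growth_pser gb.
exists m, h; split; first by exists b.
- by rewrite (pser0 bh) /b addn0.
- move=> u; apply/eqP; rewrite -subr_eq0; apply/eqP/cmod_small_eq0 => e e0.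
  have c0 : 0 < cmod (u ^+ m) + 1 by have := cmod_ge0 (u ^+ m); lra.
  have e20 : 0 < e / 2 by lra.
  have ec0 : 0 < e / 2 / (cmod (u ^+ m) + 1) by rewrite divr_gt0.
  have [N1 h1] := ag u _ e20; have [N2 h2] := bh u _ ec0.
  pose n := (N1 + N2)%N.
  have E : psum a (m + n) u = u ^+ m * psum b n u.
    rewrite /psum big_split_ord/= big1 ?add0r; last by move=> i _; rewrite mmin ?mul0r.
    by rewrite mulr_sumr; apply: eq_bigr => i _; rewrite exprD /b; ring.
  have -> : g u - u ^+ m * h u = (g u - psum a (m + n) u) - u ^+ m * (h u - psum b n u).
    by rewrite E; ring.
  apply: (le_trans (cmodB _ _)); rewrite cmodM.
  have /ltW {}h1 : cmod (g u - psum a (m + n) u) < e / 2 by apply: h1; rewrite /n; lia.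
  have /ltW {}h2 : cmod (h u - psum b n u) < e / 2 / (cmod (u ^+ m) + 1) by apply: h2; rewrite /n; lia.
  have : (cmod (u ^+ m) + 1) * (e / 2 / (cmod (u ^+ m) + 1)) = e / 2 by rewrite mulrC divfK// gt_eqF.
  have := cmod_ge0 (h u - psum b n u); have := cmod_ge0 (u ^+ m).
  by move: h1 h2; set x := cmod (h u - _); nra.
Qed.

End PowerSeries.

(** * Coefficient estimates by averaging over roots of unity *)

Section CircleAverages.
Variable R : realType.
Local Notation C := R[i].
Implicit Types (c : nat -> C) (x : C) (r A M : R).

Lemma prim_root_exists N : (0 < N)%N -> exists x : C, N.-primitive_root x.
Proof.
move=> N0; pose p : {poly C} := 'X^N - 1; have [s Dp] := closed_field_poly_normal p.
rewrite (monicP _) ?monicXnsubC // scale1r in Dp.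
have rn1: all N.-unity_root s by apply/allP=> z; rewrite -root_prod_XsubC -Dp.
have sz_r: (N < (size s).+1)%N.
  by rewrite -(size_prod_XsubC s id) -Dp size_XnsubC.
have [|z] := hasP (has_prim_root N0 rn1 _ sz_r); last by exists z.
by rewrite -separable_prod_XsubC -Dp separable_Xn_sub_1 // pnatr_eq0 -lt0n.
Qed.

Lemma cmod_prim_root N x : N.-primitive_root x -> cmod x = 1.
Proof.
move=> px; apply/eqP; rewrite -(@pexpr_eq1 _ _ N) ?cmod_ge0 ?(prim_order_gt0 px)//.
by rewrite -cmodX (prim_expr_order px) cmod1.
Qed.

Lemma sum_prim_root N x m : N.-primitive_root x ->
  \sum_(j < N) (x ^+ m) ^+ j = if (N %| m)%N then N%:R else 0.
Proof.
move=> px; rewrite (prim_order_dvd px); case: eqVneq => [->|xm].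
  rewrite (eq_bigr (fun=> 1)); last by move=> i _; rewrite expr1n.
  by rewrite sumr_const card_ord.
apply: (mulfI (_ : x ^+ m - 1 != 0)); first by rewrite subr_eq0.
by rewrite mulr0 -subrX1 exprAC (prim_expr_order px) expr1n subrr.
Qed.

Lemma sum_psum_prim N x c n r m : N.-primitive_root x ->
  \sum_(j < N) psum c n ((r%:C)%C * x ^+ j) * (x ^+ m) ^+ j =
  \sum_(i < n) c i * (r%:C)%C ^+ i * (if (N %| i + m)%N then N%:R else 0).
Proof.
move=> px; under eq_bigr => j _ do rewrite /psum mulr_suml.
rewrite exchange_big/=; apply: eq_bigr => i _.
rewrite -(sum_prim_root (i + m) px) mulr_sumr; apply: eq_bigr => j _.
by rewrite exprMn exprD exprMn -!mulrA [x ^+ j ^+ i]exprAC; ring.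
Qed.

(** A discrete Fourier coefficient: the weight x^(-kj) is written x^((N-k)j). With at most N
    frequencies there is no aliasing, since N divides i + N - k only for i = k. *)
Lemma sum_psum_coef N x c n r k : N.-primitive_root x -> (n <= N)%N -> (k < n)%N ->
  \sum_(j < N) psum c n ((r%:C)%C * x ^+ j) * (x ^+ (N - k)) ^+ j =
  N%:R * (c k * (r%:C)%C ^+ k).
Proof.
move=> px nN kn; rewrite (sum_psum_prim _ _ _ _ px) (bigD1 (Ordinal kn))//= big1.
  by rewrite subnKC ?dvdnn ?addr0 ?(mulrC N%:R)//; lia.
move=> i ik; case: ifPn => [/dvdnP[q E]|]; last by rewrite mulr0.
have {}ik : nat_of_ord i <> k by move=> H; case/eqP: ik; apply: val_inj.
have := ltn_ord i; case: q E => [|[|q]] E; [lia|lia|].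
by rewrite !mulSn in E; lia.
Qed.

Lemma psum_coef_le c n r M : 0 <= r ->
  (forall z, cmod z = r -> cmod (psum c n z) <= M) ->
  forall k, (k < n)%N -> cmod (c k) * r ^+ k <= M.
Proof.
move=> r0 hM k kn; have n0 : (0 < n)%N by case: n kn {hM}.
have [x px] := prim_root_exists n0.
have x1 := cmod_prim_root px.
have n0' : 0 < n%:R :> R by rewrite ltr0n.
rewrite -(ler_pM2l n0').
have -> : n%:R * (cmod (c k) * r ^+ k) = cmod (n%:R * (c k * (r%:C)%C ^+ k)).
  by rewrite !cmodM cmodX cmod_real cmod_nat ger0_norm.
rewrite -(sum_psum_coef c r px (leqnn n) kn) (le_trans (cmod_sum _ _))//.
rewrite mulr_natl -[X in M *+ X]card_ord -sumr_const; apply: ler_sum => j _.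
rewrite cmodM !cmodX x1 !expr1n mulr1 hM// cmodM cmodX x1 expr1n mulr1.
by rewrite cmod_real ger0_norm.
Qed.

Lemma conjc_cmod1 (u : C) : cmod u = 1 -> (u^*)%C = u^-1.
Proof. by move=> u1; rewrite invc_norm -cmodE u1 expr1n invr1 mul1r. Qed.

Lemma cmod_rotation (u : C) : exists2 v, cmod v = 1 & v * u = ((cmod u)%:C)%C.
Proof.
have [->|u0] := eqVneq u 0; first by exists 1; rewrite ?cmod1 // mulr0 cmod0.
exists (((cmod u)%:C)%C / u); last by rewrite divfK.
by rewrite cmodM cmodV cmod_real ger0_norm ?cmod_ge0// divff// cmod_eq0.
Qed.

(* Averaging Re(c_1 z + ... ) against the nonnegative kernel 2 + 2 Re(v z^-k). *)
Lemma borel_caratheodory_psum c n r A : 0 <= r -> c 0%N = 0 ->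
  (forall z, cmod z = r -> complex.Re (psum c n z) <= A) ->
  forall k, (0 < k < n)%N -> cmod (c k) * r ^+ k <= 2 * A.
Proof.
move=> r0 c0 hA k /andP[k0 kn].
(* Twice as many nodes as coefficients: then 0 < i + k < N for all i < n, so the average of Q
   against the conjugate weight vanishes ([S2]). *)
pose N := n.*2; have N0 : (0 < N)%N by rewrite /N; lia.
have [x px] := prim_root_exists N0.
have x1 := cmod_prim_root px.
have N0' : 0 < N%:R :> R by rewrite ltr0n.
(* The unit factor v turns c_k r^k into its modulus, so that the real part of the average loses
   nothing. *)
have [v v1 vE] := cmod_rotation (c k * (r%:C)%C ^+ k).
pose Q j := psum c n ((r%:C)%C * x ^+ j).
pose W j := v * (x ^+ (N - k)) ^+ j.
have W1 j : cmod (W j) = 1 by rewrite cmodM v1 !cmodX x1 !expr1n mulr1.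
have WJ j : ((W j)^*)%C = v^-1 * (x ^+ k) ^+ j.
  rewrite conjc_cmod1// /W invfM; congr (_ * _).
  have h : (x ^+ (N - k)) ^+ j * (x ^+ k) ^+ j = 1.
    by rewrite -exprMn -exprD subnK ?(prim_expr_order px) ?expr1n// /N; lia.
  have nz : (x ^+ (N - k)) ^+ j != 0 by rewrite -cmod_gt0 !cmodX x1 !expr1n.
  by apply: (mulfI nz); rewrite h mulfV.
have S0 : \sum_(j < N) Q j = 0.
  have := @sum_psum_prim N x c n r 0 px.
  under eq_bigr do rewrite expr0 expr1n mulr1.
  move=> ->; apply: big1 => -[[|i] hi] _ /=; first by rewrite c0 !mul0r.
  rewrite addn0; case: ifPn => [/dvdn_leq|]; last by rewrite mulr0.
  by rewrite /N; lia.
have S1 : \sum_(j < N) Q j * W j = N%:R * ((cmod (c k * (r%:C)%C ^+ k))%:C)%C.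
  rewrite -vE mulrCA -(@sum_psum_coef N x c n r k px)//; last by rewrite /N; lia.
  by rewrite mulr_sumr; apply: eq_bigr => j _; rewrite /W mulrCA.
have S2 : \sum_(j < N) Q j * ((W j)^*)%C = 0.
  transitivity (v^-1 * \sum_(j < N) Q j * (x ^+ k) ^+ j).
    by rewrite mulr_sumr; apply: eq_bigr => j _; rewrite WJ mulrCA.
  rewrite (sum_psum_prim _ _ _ _ px) big1 ?mulr0// => i _.
  case: ifPn => [/dvdn_leq|]; last by rewrite mulr0.
  by have := ltn_ord i; rewrite /N; lia.
have SW : \sum_(j < N) complex.Re (W j) = 0.
  rewrite -Re_sum -mulr_sumr (sum_prim_root _ px).
  case: ifPn => [/dvdn_leq|]; last by rewrite mulr0.
  by rewrite /N; lia.
have key : \sum_(j < N) complex.Re (Q j) * (2 + 2 * complex.Re (W j)) =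
    N%:R * (cmod (c k) * r ^+ k).
  transitivity (complex.Re (\sum_(j < N) (2 * Q j + (Q j * W j + Q j * ((W j)^*)%C)))).
    rewrite Re_sum; apply: eq_bigr => j _.
    rewrite (_ : 2 * Q j = Q j + Q j); last by ring.
    by case: (Q j) => a b; case: (W j) => d e /=; ring.
  rewrite !big_split/= -mulr_sumr S0 S1 S2 mulr0 add0r addr0.
  rewrite -(rmorph_nat (real_complex R)) Re_scale /=.
  by rewrite cmodM cmodX cmod_real ger0_norm.
rewrite -(ler_pM2l N0') -key.
apply: (@le_trans _ _ (\sum_(j < N) A * (2 + 2 * complex.Re (W j)))).
  apply: ler_sum => j _; apply: ler_wpM2r.
    have := normRe_le_cmod (W j); rewrite W1 ler_norml; lra.
  by apply: hA; rewrite cmodM cmodX x1 expr1n mulr1 cmod_real ger0_norm.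
rewrite -mulr_sumr big_split/= -mulr_sumr SW mulr0 addr0 sumr_const card_ord.
by rewrite -mulr_natr; nra.
Qed.

(** The polynomial case applied to a long Taylor polynomial, which is bounded by M + e on the circle
    because truncation is uniform there. *)
Lemma cauchy_estimate a (f : C -> C) r M : pser a f -> 0 <= r ->
  (forall z, cmod z = r -> cmod (f z) <= M) ->
  forall k, cmod (a k) * r ^+ k <= M.
Proof.
move=> af r0 hM k; apply: le_of_eps => e e0.
have r10 : 0 < r + 1 by lra.
have [B B0 hB] := pser_unif af r10.
have hh : 0 <= (2^-1 : R) < 1 by lra.
have [N hN] := exp_small hh e0 B0.
apply: (@psum_coef_le a (N + k.+1)%N r (M + e)) => //; last by lia.
move=> z zr.
have -> : psum a (N + k.+1) z = f z - (f z - psum a (N + k.+1) z) by ring.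
rewrite (le_trans (cmodB _ _))// lerD//; first exact: hM.
apply: le_trans (hB _ _ _) _; first by lra.
by apply/ltW/hN; lia.
Qed.

Lemma entire0_le (f : C -> C) r M : entire f -> 0 <= r ->
  (forall z, cmod z = r -> cmod (f z) <= M) -> cmod (f 0) <= M.
Proof.
move=> [a af] r0 hM.
by have := cauchy_estimate af r0 hM 0; rewrite expr0 mulr1 (pser0 af).
Qed.

(** A weak maximum principle read off from the coefficient bounds. The factor 2 is the sum of the
    geometric series on the half disk; it is affordable because M is later used only under a
    logarithm. *)
Lemma entire_disk_le (f : C -> C) r M : entire f -> 0 < r ->
  (forall z, cmod z = r -> cmod (f z) <= M) ->
  forall z, cmod z <= r / 2 -> cmod (f z) <= 2 * M.
Proof.
move=> [a af] r0 hM z zr.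
have hq : 0 <= (2^-1 : R) <= 2^-1 by lra.
have zr' : cmod z <= 2^-1 * r by rewrite mulrC.
have := pser_tail 0 af (cauchy_estimate af (ltW r0) hM) hq zr'.
by rewrite /psum big_ord0 subr0 expr0 mulr1.
Qed.

End CircleAverages.

(** * The truncated logarithm series for ln |1 - v| *)

Section LogSeries.
Variable R : realType.
Local Notation C := R[i].

Lemma sqr_cmod (z : C) : cmod z ^+ 2 = complex.Re z ^+ 2 + complex.Im z ^+ 2.
Proof. by case: z => x y; rewrite /cmod/= sqr_sqrtr// addr_ge0 ?sqr_ge0. Qed.

Lemma Re_div (u v : C) :
  complex.Re (u / v) = (complex.Re u * complex.Re v + complex.Im u * complex.Im v) / cmod v ^+ 2.
Proof. by rewrite sqr_cmod; case: u => a b; case: v => d e /=; ring. Qed.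

(** Mean value theorem along the segment from 0 to v, for a real function of t in [0, 1]; no complex
    logarithm occurs. *)
Lemma ln_cmod_1B (v : C) n : cmod v < 1 ->
  `|ln (cmod (1 - v)) + complex.Re (\sum_(k < n) v ^+ k.+1 / k.+1%:R)|
    <= cmod v ^+ n.+1 / (1 - cmod v).
Proof.
move=> v1.
have v0 := cmod_ge0 v.
pose x := complex.Re v; pose y := complex.Im v.
(* The squared modulus of 1 - tv is a real polynomial in t, which is why [G] carries twice the
   quantity to be estimated. *)
pose D : {poly R} := 1 - (2 * x) *: 'X + (x ^+ 2 + y ^+ 2) *: 'X^2.
pose S : {poly R} := \sum_(k < n) (complex.Re (v ^+ k.+1) / k.+1%:R) *: 'X^(k.+1).
have DE t : D.[t] = cmod (1 - (t%:C)%C * v) ^+ 2.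
  rewrite /D !hornerE sqr_cmod /x /y; case: v {v1 v0 D S x y} => x y /=; ring.
have D'E t : D^`().[t] = - 2 * x + 2 * (x ^+ 2 + y ^+ 2) * t.
  by rewrite /D -polyC1 !(derivD, derivN, derivZ, derivX, derivXn, derivC) !hornerE; ring.
have S'E t : S^`().[t] = complex.Re (\sum_(k < n) v ^+ k.+1 * (t%:C)%C ^+ k).
  rewrite /S raddf_sum/= horner_sum Re_sum; apply: eq_bigr => k _.
  rewrite derivZ derivXn hornerZ hornerMn hornerXn /=.
  rewrite -(rmorphXn (real_complex R)) [v ^+ _ * _]mulrC Re_scale -[t ^+ k *+ _]mulr_natr.
  have := pnatr_eq0 R k.+1; move: (k.+1%:R : R) => K /negbT K0.
  by field.
have tv (t : R) : 0 <= t <= 1 -> 1 - cmod v <= cmod (1 - (t%:C)%C * v).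
  move=> /andP[t0 t1]; apply: le_trans (cmodB_ge _ _).
  by rewrite cmod1 cmodM cmod_real ger0_norm//; nra.
have Dpos (t : R) : 0 <= t <= 1 -> 0 < D.[t].
  by move=> /tv h; rewrite DE exprn_gt0//; lra.
pose G : R -> R := (@ln R \o horner D) + horner (2 *: S).
have GE t : G t = ln D.[t] + 2 * S.[t] by rewrite /G fctE/= hornerZ.
pose dG t := D.[t]^-1 * D^`().[t] + 2 * S^`().[t].
have dGP (t : R) : 0 <= t <= 1 -> is_derive t 1 G (dG t).
  move=> ht; rewrite /dG -hornerZ -derivZ; apply: is_deriveD.
  by apply: is_derive1_comp; apply: is_derive1_ln; exact: Dpos.
have dG_le (t : R) : 0 <= t <= 1 -> `|dG t| <= 2 * (cmod v ^+ n.+1 / (1 - cmod v)).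
  move=> ht; have hd := tv t ht.
  pose d := 1 - (t%:C)%C * v.
  have d0 : d != 0 by rewrite -cmod_gt0 /d; lra.
  have Sd : \sum_(k < n) v ^+ k.+1 * (t%:C)%C ^+ k = v / d - v * ((t%:C)%C * v) ^+ n / d.
    apply: (mulIf d0); rewrite mulrBl !divfK//.
    have E : \sum_(k < n) v ^+ k.+1 * (t%:C)%C ^+ k = v * \sum_(k < n) ((t%:C)%C * v) ^+ k.
      by rewrite mulr_sumr; apply: eq_bigr => k _; rewrite exprS exprMn; ring.
    have := subrX1 ((t%:C)%C * v) n; rewrite E; move: (\sum_(k < n) _) => s Es.
    by rewrite -[_ ^+ n](subrK 1) Es /d; ring.
  (* The derivative of the truncated series is a finite geometric sum; its main part cancels D'/D
     and the geometric remainder is left. *)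
  have -> : dG t = - 2 * complex.Re (v * ((t%:C)%C * v) ^+ n / d).
    rewrite /dG S'E Sd ReB DE D'E (Re_div v d) /d.
    rewrite /x /y /=.
    have -> : complex.Re v * complex.Re (1 - (t%:C)%C * v) + complex.Im v * complex.Im (1 - (t%:C)%C * v)
       = complex.Re v - t * (complex.Re v ^+ 2 + complex.Im v ^+ 2).
      by case: (v) => a b /=; ring.
    by field; rewrite cmod_eq0.
  rewrite normrM normrN (ger0_norm (ler0n R 2)); apply: ler_wpM2l => //.
  rewrite (le_trans (normRe_le_cmod _))// !cmodM cmodV cmodX cmodM cmod_real.
  have /andP[t0 t1] := ht; rewrite ger0_norm//.
  apply: ler_pM; rewrite ?mulr_ge0 ?invr_ge0 ?exprn_ge0 ?mulr_ge0 ?cmod_ge0//.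
    rewrite exprS ler_wpM2l// lerXn2r// ?nnegrE ?mulr_ge0//; nra.
  by rewrite lef_pV2// posrE /d; lra.
have [t|t|t ht E] := @MVT_segment R G dG 0 1 ler01.
- by rewrite in_itv/= => /andP[t0 t1]; apply: dGP; lra.
- apply: derivable_within_continuous => s; rewrite in_itv/= => hs.
  by apply: ex_derive; exact: dGP.
have G0 : G 0 = 0.
  rewrite GE DE mul0r subr0 cmod1 expr1n ln1 add0r /S horner_sum big1 ?mulr0// => k _.
  by rewrite hornerZ hornerXn expr0n/= mulr0.
have G1 : G 1 = 2 * (ln (cmod (1 - v)) + complex.Re (\sum_(k < n) v ^+ k.+1 / k.+1%:R)).
  rewrite GE DE mul1r lnXn; last by rewrite cmod_gt0 subr_eq0; apply/eqP => H; move: v1; rewrite -H cmod1 ltxx.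
  rewrite -[ln _ *+ 2]mulr_natl -mulrDr; congr (2 * (_ + _)).
  rewrite /S horner_sum Re_sum; apply: eq_bigr => k _.
  rewrite hornerZ hornerXn expr1n mulr1 mulrC [in RHS]mulrC.
  by rewrite -(rmorph_nat (real_complex R)) -fmorphV Re_scale.
move: E; rewrite G0 G1 subr0 subr0 mulr1 => E.
have := dG_le t; rewrite in_itv/= in ht => /(_ ht); rewrite -E normrM ger0_norm//.
by rewrite ler_pM2l.
Qed.

End LogSeries.

(** * Zero-free functions on a disk *)

Section ZeroFree.
Variable R : realType.
Local Notation C := R[i].

Lemma seq_sup_lt1 (s : seq R) : all (fun x => 0 <= x < 1) s ->
  exists2 q, 0 <= q < 1 & all (fun x => x <= q) s.
Proof.
elim: s => [_|x s IH /= /andP[x01 /IH[q q01 hq]]]; first by exists 0 => //; rewrite lexx ltr01.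
exists (Num.max x q); first by rewrite le_max gt_max; case/andP: x01 => -> ->; case/andP: q01 => _ ->.
rewrite le_max lexx/=; apply: sub_all hq => y yq; by rewrite le_max yq orbT.
Qed.

(** All roots b lie outside the disk, so ln |p(z)/p(0)| is the sum of the ln |1 - z/b|, up to a
    small error the real part of a polynomial without constant term. That real part is at most about
    ln K on the circle, so Borel-Caratheodory bounds the k-th coefficient by about 2 ln K / r^k, and
    summation over the half disk gives 4 ln K |z|/r. *)
Lemma poly_zero_free_le (p : {poly C}) (r K : R) : 0 < r -> p.[0] != 0 ->
  (forall z, cmod z <= r -> p.[z] != 0) ->
  (forall z, cmod z <= r -> cmod p.[z] <= K * cmod p.[0]) ->
  forall z, cmod z <= r / 2 ->
    cmod p.[z] <= cmod p.[0] * expR (4 * ln K * cmod z / r).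
Proof.
move=> r0 p0 hp hK.
have p00 : 0 < cmod p.[0] by rewrite cmod_gt0.
have K1 : 1 <= K.
  by have := hK 0; rewrite cmod0 => /(_ (ltW r0)); rewrite ler_pMl.
have A0 : 0 <= ln K by exact: ln_ge0.
have [s Dp] := closed_field_poly_normal p.
have l0 : lead_coef p != 0 by apply: contraNneq p0 => h; rewrite Dp h scale0r horner0.
have sr b : b \in s -> r < cmod b.
  move=> bs; rewrite ltNge; apply/negP => /hp; rewrite Dp hornerZ mulf_eq0 (negbTE l0)/=.
  by rewrite -[_ == 0]/(root _ _) root_prod_XsubC bs.
have sn0 b : b \in s -> b != 0 by move=> /sr h; rewrite -cmod_gt0; lra.
have pE z : p.[z] = p.[0] * \prod_(b <- s) (1 - z / b).
  rewrite Dp !hornerZ !horner_prod -mulrA -big_split/=; congr (_ * _).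
  rewrite !big_seq; apply: eq_bigr => b /sn0 b0.
  by rewrite !hornerXsubC; field.
pose u z := \sum_(b <- s) ln (cmod (1 - z / b)).
have uE z : cmod z <= r -> cmod p.[z] = cmod p.[0] * expR (u z).
  move=> zr; rewrite pE cmodM cmod_prod /u expR_sum; congr (_ * _).
  rewrite !big_seq; apply: eq_bigr => b bs; rewrite lnK// posrE cmod_gt0.
  have := hp _ zr; rewrite pE mulf_eq0 negb_or => /andP[_].
  by rewrite (big_rem b)//= mulf_eq0 negb_or => /andP[].
have uA z : cmod z <= r -> u z <= ln K.
  move=> zr; rewrite -ler_expR lnK ?posrE ?(lt_le_trans ltr01)//.
  by have := hK z zr; rewrite (uE z zr) mulrC ler_pM2r.
(* Finitely many roots outside the closed disk leave a uniform gap, hence a truncation error that is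
   uniform on the disk. *)
have [q /andP[q0 q1] hq] : exists2 q, 0 <= q < 1 & all (fun x => x <= q) [seq r / cmod b | b <- s].
  apply: seq_sup_lt1; apply/allP => _ /mapP[b /sr bs ->].
  by rewrite divr_ge0 ?cmod_ge0 ?ltW//= ltr_pdivrMr ?mul1r//; lra.
(* The Taylor coefficients of log(p/p(0)). For k = 0 the convention that the inverse of 0 is 0 gives
   the desired value 0. *)
pose c k : C := - \sum_(b <- s) b^-1 ^+ k / k%:R.
have c0 : c 0%N = 0.
  by rewrite /c big1 ?oppr0// => b _; rewrite mulr0n invr0 mulr0.
have cE n z : psum c n.+1 z = - \sum_(b <- s) \sum_(k < n) (z / b) ^+ k.+1 / k.+1%:R.
  rewrite /psum big_ord_recl c0 mul0r add0r exchange_big/= -sumrN.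
  apply: eq_bigr => k _; rewrite /c /bump/= add1n mulNr mulr_suml; congr (- _).
  by apply: eq_bigr => b _; rewrite exprMn; ring.
pose eps n := (size s)%:R * (q ^+ n.+1 / (1 - q)).
have uc n z : cmod z <= r -> `|u z - complex.Re (psum c n.+1 z)| <= eps n.
  move=> zr; rewrite cE.
  have -> : u z - complex.Re (- \sum_(b <- s) \sum_(k < n) (z / b) ^+ k.+1 / k.+1%:R)
    = \sum_(b <- s) (ln (cmod (1 - z / b)) + complex.Re (\sum_(k < n) (z / b) ^+ k.+1 / k.+1%:R)).
    by rewrite -sumrN Re_sum -sumrN -big_split/=; apply: eq_bigr => b _; case: (\sum_(k < n) _) => x y /=; rewrite opprK.
  rewrite (le_trans (ler_norm_sum _ _ _))//.
  have -> : eps n = \sum_(b <- s) (q ^+ n.+1 / (1 - q)).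
    by rewrite big_const_seq count_predT iter_addr addr0 /eps mulr_natl.
  rewrite !big_seq.
  apply: ler_sum => b bs; have rb := sr b bs.
  have zb : cmod (z / b) <= q.
    apply: le_trans (allP hq _ (map_f (fun b => r / cmod b) bs)).
    by rewrite cmodM cmodV ler_wpM2r// invr_ge0 cmod_ge0.
  have zb1 : cmod (z / b) < 1 by lra.
  apply: (le_trans (ln_cmod_1B n zb1)).
  apply: ler_pM; rewrite ?exprn_ge0 ?invr_ge0 ?cmod_ge0//; first by lra.
    by rewrite lerXn2r// ?nnegrE ?cmod_ge0.
  by rewrite lef_pV2// ?posrE; lra.
have eps0 n : 0 <= eps n by rewrite mulr_ge0// divr_ge0 ?exprn_ge0//; lra.
have bound n z : cmod z <= r / 2 -> u z <= 4 * (ln K + eps n) * cmod z / r + eps n.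
  move=> zr.
  have hc k : cmod (c k) * r ^+ k <= 2 * (ln K + eps n) \/ (n < k)%N.
    have [kn|] := leqP k n; [left|by right].
    case: k kn => [_|k kn].
      by rewrite c0 cmod0 mul0r mulr_ge0// addr_ge0.
    apply: (@borel_caratheodory_psum R c n.+1 r); rewrite ?ltW//.
    move=> w wr; have wr' : cmod w <= r by rewrite wr.
    by have := uc n w wr'; rewrite ler_norml => /andP[h _]; have := uA w wr'; lra.
  have zr' : cmod z <= r by lra.
  have := uc n z zr'; rewrite ler_norml => /andP[_ h].
  suff : complex.Re (psum c n.+1 z) <= 4 * (ln K + eps n) * cmod z / r by lra.
  apply: le_trans (Re_le_cmod _) _.
  rewrite /psum big_ord_recl c0 mul0r add0r (le_trans (cmod_sum _ _))//.
  pose x := cmod z / r.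
  have x0 : 0 <= x by rewrite divr_ge0 ?cmod_ge0// ltW.
  have x2 : x <= 2^-1 by rewrite /x ler_pdivrMr// mulrC.
  apply: (@le_trans _ _ (2 * (ln K + eps n) * \sum_(1 <= k < n.+1) x ^+ k)).
    rewrite big_add1 big_mkord mulr_sumr; apply: ler_sum => k _.
    rewrite cmodM cmodX lift0.
    have [hk|] := hc k.+1; last by rewrite ltnNge ltn_ord.
    apply: le_trans (ler_wpM2r (exprn_ge0 k.+1 x0) hk).
    by rewrite -mulrA -exprMn /x mulrCA divff ?mulr1// gt_eqF.
  have h4 := @geom_tail_le R x 1 n.+1; rewrite x0 x2 expr1 in h4.
  have -> : 4 * (ln K + eps n) * cmod z / r = 2 * (ln K + eps n) * (2 * x) by rewrite /x; ring.
  by apply: ler_wpM2l (h4 isT); rewrite mulr_ge0// addr_ge0.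
move=> z zr; rewrite uE; last by lra.
rewrite ler_pM2l// ler_expR; apply: le_of_eps => e e0.
have q01 : 0 <= q < 1 by rewrite q0.
(* The error is (4|z|/r + 1) [eps], and |z|/r <= 1/2 makes the first factor at most 3. *)
have cc0 : 0 <= 3 * ((size s)%:R * (q / (1 - q))).
  by rewrite !mulr_ge0// invr_ge0; lra.
have [N hN] := exp_small q01 e0 cc0; have {}hN := hN N (leqnn N).
apply: (le_trans (bound N z zr)).
have -> : 4 * (ln K + eps N) * cmod z / r + eps N = 4 * ln K * cmod z / r + (4 * (cmod z / r) + 1) * eps N by ring.
rewrite lerD2l; apply: le_trans (ltW hN).
have -> : 3 * ((size s)%:R * (q / (1 - q))) * q ^+ N = 3 * eps N by rewrite /eps exprS; ring.
apply: ler_wpM2r => //.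
have : cmod z / r <= 2^-1 by rewrite ler_pdivrMr// mulrC.
by lra.
Qed.

(** Stated on the real plane, where compactness of the disk is a matter of closed and bounded sets.
    Continuity is the local Lipschitz bound given by f(u) - f(w) = (u - w) q(u) with q bounded near
    w. *)
Lemma entire_continuous2 (f : C -> C) : entire f ->
  continuous (fun t : R * R => cmod (f (Complex t.1 t.2))).
Proof.
move=> ef [x0 y0]; pose w := Complex x0 y0.
have [q eq qE] := entire_quotient w ef.
have [B B0 hB] := entire_bounded (cmod w + 2) eq.
apply/cvgrPdist_le => e e0 /=.
pose d := Num.min 1 (e / (2 * (B + 1))).
have d0 : 0 < d by rewrite lt_min ltr01 divr_gt0//; lra.
near=> t.
have [h1 h2] : `|x0 - t.1| < d /\ `|y0 - t.2| < d.
  by near: t; exact: (nbhsx_ballx (x0, y0) d d0).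
set u := Complex t.1 t.2.
have uw : cmod (u - w) <= 2 * d.
  rewrite (le_trans (cmod_le_ReIm _))// /= -(distrC x0) -(distrC y0); lra.
have d1 : d <= 1 by rewrite ge_min lexx.
have de : d * (2 * (B + 1)) <= e by rewrite -ler_pdivlMr ?ge_min ?lexx ?orbT//; lra.
have h : cmod (f u - f w) <= e.
  rewrite qE cmodM.
  have : cmod (q u) <= B.
    apply: hB; have -> : u = w + (u - w) by ring.
    by rewrite (le_trans (cmodD _ _))//; lra.
  have := cmod_ge0 (q u); have := cmod_ge0 (u - w); nra.
have := cmodB_ge (f u) (f w); have := cmodB_ge (f w) (f u); rewrite (cmodBC (f w)).
by rewrite ler_norml; lra.
Unshelve. all: by end_near.
Qed.

Lemma entire_id : entire (fun z : C => z).
Proof.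
exists (fun k => (k == 1%N)%:R) => z e e0; exists 2%N => -[|[|n]]// _.
rewrite !big_ord_recl/= big1 ?mul0r ?add0r ?addr0 ?mul1r ?expr1 ?subrr ?cmod0//.
by move=> i _; rewrite mul0r.
Qed.

(** A uniform lower bound is what keeps nearby Taylor polynomials zero-free on the same disk. *)
Lemma zero_free_min (f : C -> C) (r : R) : entire f -> 0 < r ->
  (forall z, cmod z <= r -> f z != 0) ->
  exists2 d, 0 < d & forall z, cmod z <= r -> d <= cmod (f z).
Proof.
move=> ef r0 hf.
pose A : set (R * R) := [set t | cmod (Complex t.1 t.2) <= r].
have A0 : A !=set0 by exists (0, 0); rewrite /A/= expr0n/= addr0 sqrtr0 ltW.
have Ac : compact A.
  apply: (@subclosed_compact _ _ (`[- r, r] `*` `[- r, r])).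
  - have -> : A = (fun t : R * R => cmod (Complex t.1 t.2)) @^-1` [set x | x <= r] by [].
    apply: (closed_comp (f := fun t : R * R => cmod (Complex t.1 t.2))).
      by move=> t _; exact: (entire_continuous2 entire_id).
    exact: closed_le.
  - by apply: compact_setX; exact: segment_compact.
  - move=> [x y] /= h; split => /=; rewrite in_itv/= -ler_norml; apply: le_trans h.
      exact: (normRe_le_cmod (Complex x y)).
    exact: (normIm_le_cmod (Complex x y)).
have [|[x y] /[1!inE] Axy hmin] :=
    @compact_EVT_min _ R (fun t : R * R => cmod (f (Complex t.1 t.2))) A A0 Ac.
  by apply: continuous_subspaceT; exact: entire_continuous2 ef.
exists (cmod (f (Complex x y))); first by rewrite cmod_gt0; exact: hf.
by case=> a b hab; apply: (hmin (a, b)); rewrite inE.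
Qed.

Lemma zero_free_le (f : C -> C) (r K : R) : entire f -> 0 < r ->
  (forall z, cmod z <= r -> f z != 0) ->
  (forall z, cmod z <= r -> cmod (f z) <= K * cmod (f 0)) ->
  forall z, cmod z <= r / 2 ->
    cmod (f z) <= cmod (f 0) * expR (4 * ln (2 * K) * cmod z / r).
Proof.
move=> ef r0 hf hK z zr.
have f00 : 0 < cmod (f 0) by rewrite cmod_gt0 hf// cmod0 ltW.
have K1 : 1 <= K.
  by have := hK 0; rewrite cmod0 => /(_ (ltW r0)); rewrite ler_pMl.
have [d d0 hd] := zero_free_min ef r0 hf.
have [a af] := ef.
have [B B0 hB] := pser_unif af r0.
have fa0 := pser0 af.
apply: le_of_eps => e e0.
(* The three bounds serve in turn: the final error e, a Taylor polynomial that does not vanish on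
   the disk, and its bound K|f(0)| + |f(0)| <= 2K|f(0)|. *)
pose e' := Num.min e (Num.min (d / 2) (cmod (f 0))).
have e'0 : 0 < e' by rewrite !lt_min e0 f00 divr_gt0.
have hh : 0 <= (2^-1 : R) < 1 by lra.
have [N hN] := exp_small hh e'0 B0; have {}hN := hN N.+1 (leqnSn N).
have e'e : e' <= e by rewrite ge_min lexx.
have e'd : e' <= d / 2 by rewrite !ge_min lexx orbT.
have e'f : e' <= cmod (f 0) by rewrite !ge_min lexx !orbT.
have {}hB w : cmod w <= r -> cmod (f w - psum a N.+1 w) <= e'.
  by move=> /hB h; apply: le_trans (h _) (ltW hN).
pose p : {poly C} := \poly_(k < N.+1) a k.
have pE w : p.[w] = psum a N.+1 w by rewrite horner_poly.
have p0 : p.[0] = f 0 by rewrite pE /psum big_ord_recl big1 ?addr0 ?expr0 ?mulr1// => i _; rewrite expr0n/= mulr0.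
have := @poly_zero_free_le p r (2 * K) r0.
rewrite p0 => /(_ _ _ _ z zr) h.
have -> : f z = (f z - p.[z]) + p.[z] by ring.
rewrite (le_trans (cmodD _ _))// addrC lerD//.
  apply: h.
  - by rewrite -cmod_gt0.
  - move=> w wr; rewrite -cmod_gt0 pE; have := hB w wr; have := hd w wr.
    by have := cmodB_ge (f w) (f w - psum a N.+1 w); rewrite subKr; lra.
  - move=> w wr; rewrite pE; have := hB w wr; have := hK w wr.
    by have := cmodB (f w) (f w - psum a N.+1 w); rewrite subKr; nra.
rewrite pE; apply: le_trans (hB _ _) e'e; by lra.
Qed.

End ZeroFree.

(** * Zeros in a disk and the Hadamard product bound *)

Section Zeros.
Variable R : realType.
Local Notation C := R[i].
Implicit Types (g h p : C -> C) (s : seq C) (r M : R) (w z : C).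

(** Zeros in the open disk, repeated by multiplicity; the factorization encodes multiplicities
    without derivatives. *)
Definition zero_list g r s := exists p,
  [/\ entire p, forall u, g u = (\prod_(a <- s) (u - a)) * p u,
      all (fun a => cmod a < r) s & forall w, cmod w < r -> p w != 0].

Lemma entire_mul_prod s p : entire p -> entire (fun u => (\prod_(a <- s) (u - a)) * p u).
Proof.
elim: s => [|a s IH] ep.
  by rewrite (_ : (fun _ => _) = p)//; apply/funext => u; rewrite big_nil mul1r.
rewrite (_ : (fun _ => _) = (fun u => (u - a) * (\prod_(a <- s) (u - a) * p u))).
  by apply: entire_mulXB; exact: IH.
by apply/funext => u; rewrite big_cons mulrA.
Qed.

(** If m < m', the cofactor of the smaller power equals (u - w)^(d+1) q(u) away from w; by
    continuity it would vanish at w. *)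
Lemma zero_order_unique g w m m' : zero_order g w m -> zero_order g w m' -> m = m'.
Proof.
wlog : m m' / (m <= m')%N.
  by move=> H h1 h2; case: (leqP m m') => [mm|/ltnW mm]; [|apply/esym]; exact: H.
rewrite leq_eqVlt => /predU1P[//|mm] [p [ep pw pE]] [q [eq qw qE]].
have [d dE] : exists d, m' = (m + d.+1)%N by exists (m' - m.+1)%N; lia.
have pq u : u != w -> p u = (u - w) * ((u - w) ^+ d * q u).
  move=> uw; have uw0 : (u - w) ^+ m != 0 by rewrite expf_neq0// subr_eq0.
  by apply: (mulfI uw0); rewrite -pE qE dE exprD exprS -!mulrA.
exfalso; case/eqP: pw; apply: cmod_small_eq0 => e e0.
have [t et tE] := entire_quotient w ep.
have [B1 B10 hB1] := entire_bounded (cmod w + 1) et.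
have [B2 B20 hB2] := entire_bounded (cmod w + 1) eq.
(* The limit u -> w is replaced by one explicit point at distance x, with x (B1 + B2) <= e. *)
pose x := Num.min 1 (e / (B1 + B2 + 1)).
have x0 : 0 < x by rewrite lt_min ltr01 divr_gt0//; lra.
have x1 : x <= 1 by rewrite ge_min lexx.
have xe : x * (B1 + B2 + 1) <= e by rewrite -ler_pdivlMr ?ge_min ?lexx ?orbT//; lra.
pose u : C := w + (x%:C)%C.
have ux : cmod (u - w) = x.
  by rewrite /u addrAC subrr add0r cmod_real ger0_norm// ltW.
have uw : u != w by rewrite -subr_eq0 -cmod_gt0 ux.
have ur : cmod u <= cmod w + 1.
  apply: le_trans (cmodD _ _) _.
  by rewrite cmod_real ger0_norm ?lerD2l// ltW.
have -> : p w = (u - w) * ((u - w) ^+ d * q u) - (u - w) * t u.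
  by rewrite -pq// -tE subKr.
rewrite (le_trans (cmodB _ _))// !cmodM cmodX ux.
have xd : x ^+ d <= 1 by rewrite exprn_ile1// ltW.
have := hB1 u ur; have := hB2 u ur; have := cmod_ge0 (q u); have := cmod_ge0 (t u).
move: (cmod (q u)) (cmod (t u)) => a b b0 a0 aB bB.
have : x ^+ d * a <= B2 by have := exprn_ge0 d (ltW x0); nra.
move: (x ^+ d * a) => c cB; nra.
Qed.

Lemma zero_list_order g r s w : zero_list g r s -> cmod w < r ->
  zero_order g w (count_mem w s).
Proof.
move=> [p [ep gE sr hp]] wr.
exists (fun u => (\prod_(a <- [seq a <- s | a != w]) (u - a)) * p u); split.
- exact: entire_mul_prod.
- rewrite mulf_neq0 ?hp//; rewrite prodf_seq_neq0; apply/allP => a.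
  by rewrite mem_filter => /andP[aw _]; rewrite subr_eq0 eq_sym.
- move=> u; rewrite gE mulrA; congr (_ * _).
  elim: s {sr gE} => [|a s IH] /=; first by rewrite !big_nil expr0 mul1r.
  case: eqVneq => [->|aw] /=; first by rewrite big_cons IH add1n exprS mulrA.
  by rewrite !big_cons IH add0n mulrCA.
Qed.

Lemma zero_list_mult g r s w : zero_list g r s -> cmod w < r ->
  mult g w = count_mem w s.
Proof.
move=> gs wr; have h := zero_list_order gs wr.
by apply: xget_unique => // m hm; exact: zero_order_unique hm h.
Qed.

Lemma zero_list_mem g r s w : zero_list g r s -> cmod w < r ->
  (g w == 0) = (w \in s).
Proof.
move=> [p [ep gE sr hp]] wr; rewrite gE mulf_eq0 (negbTE (hp _ wr)) orbF.
apply/idP/idP => [|ws]; last by rewrite (big_rem w)//= subrr mul0r.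
apply: contraTT => ws; rewrite prodf_seq_neq0; apply/allP => a as_ /=.
by rewrite subr_eq0; apply: contraNneq ws => ->.
Qed.

Lemma zero_list_lt g r s : zero_list g r s -> all (fun a => cmod a < r) s.
Proof. by case=> p []. Qed.

Lemma zero_list_perm g r r' s s' : zero_list g r s -> zero_list g r' s' -> r <= r' ->
  perm_eq s [seq a <- s' | cmod a < r].
Proof.
move=> gs gs' rr; apply/allP => w _ /=; apply/eqP.
have [wr|wr] := ltP (cmod w) r.
  rewrite -(zero_list_mult gs wr) (zero_list_mult gs' (lt_le_trans wr rr)).
  rewrite count_filter; apply: eq_count => a /=.
  by case: eqVneq => [->|]; rewrite ?wr ?andbF.
rewrite (count_memPn _) ?(count_memPn _)//.
  by rewrite mem_filter ltNge wr.
by apply/negP => /(allP (zero_list_lt gs)) /=; rewrite ltNge wr.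
Qed.

Lemma zero_list_mulX g r s m : 0 < r -> zero_list g r s ->
  zero_list (fun u => u ^+ m * g u) r (nseq m 0 ++ s).
Proof.
move=> r0 [p [ep gE sr hp]]; exists p; split=> //.
- move=> u; rewrite gE mulrA big_cat/= big_nseq; congr (_ * _ * _).
  by rewrite subr0; elim: m => //= m <-; rewrite exprS.
- by rewrite all_cat sr andbT all_nseq cmod0 r0 orbT.
Qed.

Lemma prod_ge_exp (s : seq C) (F : C -> R) (c : R) : 0 <= c ->
  all (fun a => c <= F a) s -> c ^+ size s <= \prod_(a <- s) F a.
Proof.
move=> c0; elim: s => [|a s IH] /=; first by rewrite big_nil expr0.
move=> /andP[ca /IH h]; rewrite big_cons exprS ler_pM// exprn_ge0//.
Qed.

Lemma prod_le_exp (s : seq C) (F : C -> R) (c : R) :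
  all (fun a => 0 <= F a <= c) s -> 0 <= \prod_(a <- s) F a <= c ^+ size s.
Proof.
elim: s => [|a s IH] /=; first by rewrite big_nil expr0 ler01 lexx.
move=> /andP[/andP[F0 Fc] /IH/andP[p0 pc]].
by rewrite big_cons exprS mulr_ge0//= ler_pM.
Qed.

(** Origin of the radius 3r: there each factor satisfies |z - a| >= 2r, while at 0 it is at most r.
    Every zero thus gains a factor 2. *)
Lemma factor_bounds g p s r M : 0 < r ->
  (forall u, g u = (\prod_(a <- s) (u - a)) * p u) ->
  all (fun a => cmod a < r) s ->
  (forall z, cmod z = 3 * r -> cmod (g z) <= M) ->
  (forall z, cmod z = 3 * r -> cmod (p z) * (2 * r) ^+ size s <= M) /\
  cmod (g 0) <= r ^+ size s * cmod (p 0).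
Proof.
move=> r0 gE sr hM; split.
  move=> z zr; apply: le_trans (hM z zr); rewrite gE cmodM mulrC ler_wpM2r ?cmod_ge0//.
  rewrite cmod_prod prod_ge_exp//; first by lra.
  by apply: sub_all sr => a ar; have := cmodB_ge z a; lra.
rewrite gE cmodM ler_wpM2r ?cmod_ge0// cmod_prod.
suff /prod_le_exp/andP[] : all (fun a => 0 <= cmod (0 - a) <= r) s by [].
by apply: sub_all sr => a ar; rewrite sub0r cmodN cmod_ge0/= ltW.
Qed.

(** This takes the place of Jensen's formula. The cofactor p may still vanish in the disk, so the
    bound applies to any zeros divided out so far. *)
Lemma factor_size g p s r M : 0 < r -> entire p ->
  (forall u, g u = (\prod_(a <- s) (u - a)) * p u) ->
  all (fun a => cmod a < r) s ->
  (forall z, cmod z = 3 * r -> cmod (g z) <= M) ->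
  2 ^+ size s * cmod (g 0) <= M.
Proof.
move=> r0 ep gE sr hM; have [h1 h2] := factor_bounds r0 gE sr hM.
have rn0 : 0 < (2 * r) ^+ size s by rewrite exprn_gt0//; lra.
have r30 : 0 <= 3 * r by lra.
have : cmod (p 0) <= M / (2 * r) ^+ size s.
  by apply: (entire0_le ep r30) => z zr; rewrite ler_pdivlMr// h1.
rewrite ler_pdivlMr// => h3; apply: le_trans h3.
by rewrite exprMn [leRHS]mulrC -mulrA ler_pM2l// exprn_gt0.
Qed.

(** By [factor_size] only boundedly many zeros can be divided out. A list of maximal length leaves a
    cofactor without zeros, since a further zero could be divided out too. *)
Lemma zero_list_exists h r : entire h -> h 0 != 0 -> 0 < r ->
  exists s, zero_list h r s.
Proof.
move=> eh h0 r0.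
pose P n := `[< exists s p, [/\ entire p, forall u, h u = (\prod_(a <- s) (u - a)) * p u,
  all (fun a => cmod a < r) s & size s = n] >].
have P0 : exists n, P n.
  by exists 0%N; apply/asboolP; exists [::], h; split=> // u; rewrite big_nil mul1r.
have [M M0 hM] := entire_bounded (3 * r) eh.
have h00 : 0 < cmod (h 0) by rewrite cmod_gt0.
have Mh : 0 <= M / cmod (h 0) by rewrite divr_ge0// ltW.
have Pb n : P n -> (n <= Num.bound (M / cmod (h 0))%R)%N.
  move=> /asboolP[s [p [ep hE sr sn]]].
  have : 2 ^+ n * cmod (h 0) <= M.
    by rewrite -sn; apply: (factor_size r0 ep hE sr) => z zr; apply: hM; rewrite zr.
  rewrite -ler_pdivlMr// -(ler_nat R) => H.
  apply: le_trans (ltW (archi_boundP Mh)); apply: le_trans H.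
  by rewrite -natrX ler_nat ltnW// ltn_expl.
case: (ex_maxnP P0 Pb) => n /asboolP[s [p [ep hE sr sn]]] nmax.
exists s, p; split=> // w wr; apply/negP => /eqP pw.
have [q eq qE] := entire_quotient w ep.
have : P n.+1.
  apply/asboolP; exists (w :: s), q; split=> //=; rewrite ?wr ?sn//.
  by move=> u; rewrite hE big_cons -[p u]subr0 -pw qE; ring.
by move=> /nmax; rewrite ltnn.
Qed.

Lemma sum_undup_count s (Q : pred C) (phi : C -> R) :
  \sum_(w <- undup s | Q w) (count_mem w s)%:R * phi w = \sum_(w <- s | Q w) phi w.
Proof.
rewrite -[RHS]big_undup_iterop_count; apply: eq_bigr => w _.
by rewrite mulr_natl.
Qed.

Lemma zero_list_set g r s (Q : pred C) : zero_list g r s ->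
  [set w | [/\ g w = 0%R, (cmod w < r)%R & Q w]] = [set` [seq w <- undup s | Q w]].
Proof.
move=> gs; apply/seteqP; split=> w /=; rewrite mem_filter mem_undup.
  by move=> [/eqP gw wr ->]; rewrite -(zero_list_mem gs wr).
move=> /andP[Qw ws]; have wr := allP (zero_list_lt gs) w ws.
by split=> //; apply/eqP; rewrite (zero_list_mem gs wr).
Qed.

Lemma zero_list_fsum g r s (Q : pred C) (phi : C -> R) : zero_list g r s ->
  (\sum_(w \in [set w | [/\ g w = 0%R, (cmod w < r)%R & Q w]]) ((mult g w)%:R * phi w)%:E =
  (\sum_(a <- s | Q a) phi a)%:E)%E.
Proof.
move=> gs; rewrite (zero_list_set Q gs) -fsbig_seq ?filter_uniq ?undup_uniq//.
rewrite -sum_undup_count sumEFin big_filter; congr EFin.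
rewrite big_seq_cond [RHS]big_seq_cond; apply: eq_bigr => w /andP[].
rewrite mem_undup => ws _; congr (_%:R * _).
exact: zero_list_mult gs (allP (zero_list_lt gs) w ws).
Qed.

Lemma zero_list_finite g r s (Q : pred C) : zero_list g r s ->
  finite_set [set w | [/\ g w = 0%R, (cmod w < r)%R & Q w]].
Proof. by move=> gs; rewrite (zero_list_set Q gs); apply/finite_seqP; eexists. Qed.

Lemma zero_list_esum_ge g r s (Q : pred C) (phi : C -> R) : zero_list g r s ->
  ((\sum_(a <- s | Q a) phi a)%:E <=
    \esum_(w in [set w | g w = 0%R /\ Q w]) ((mult g w)%:R * phi w)%:E)%E.
Proof.
move=> gs; apply: esum_ge; exists [set w | [/\ g w = 0%R, (cmod w < r)%R & Q w]].
  by split; [exact: zero_list_finite gs|move=> w []].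
by rewrite (zero_list_fsum _ _ gs).
Qed.

Lemma zero_list_esum_le g (Q : pred C) (phi : C -> R) (B : R) :
  (forall w, 0 <= phi w) ->
  (forall r, 0 < r -> exists s, zero_list g r s /\ \sum_(a <- s | Q a) phi a <= B) ->
  (\esum_(w in [set w | g w = 0%R /\ Q w]) ((mult g w)%:R * phi w)%:E <= B%:E)%E.
Proof.
move=> phi0 H; apply: ge_ereal_sup => _ [A [finA AS] <-].
have [r r0 Ar] : exists2 r, 0 < r & forall w, A w -> cmod w < r.
  move/finite_seqP : finA => [t ->] /=.
  (* A finite set lies in some disk: each modulus is one of the summands. *)
  exists (1 + \sum_(w <- t) cmod w).
    by rewrite ltr_wpDr// sumr_ge0// => w _; exact: cmod_ge0.
  move=> w wt; rewrite (big_rem w)//= addrCA ltrDl ltr_wpDr// sumr_ge0// => u _.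
  exact: cmod_ge0.
have [s [gs sB]] := H r r0.
have : (B%:E >= \sum_(w \in [set w | [/\ g w = 0%R, (cmod w < r)%R & Q w]]) ((mult g w)%:R * phi w)%:E)%E.
  by rewrite (zero_list_fsum _ _ gs) lee_fin.
apply: le_trans; apply: lee_fsum_nneg_subset => //.
- exact: zero_list_finite gs.
- by move=> w; rewrite !inE/= => Aw; have [? ?] := AS w Aw; split=> //; exact: Ar.
- by move=> w _; rewrite lee_fin mulr_ge0.
Qed.

Lemma orbit_count_size f z r s : zero_list (orbit_fun f z) r s ->
  orbit_count f z r = ((size s)%:R%:E)%E.
Proof.
move=> gs; rewrite /orbit_count.
have -> : [set w | orbit_set f z w /\ (cmod w < r)%R] =
  [set w | [/\ orbit_fun f z w = 0, cmod w < r & xpredT w]].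
  by apply/seteqP; split=> w /= [].
rewrite esum_fset; last 2 first.
- exact: zero_list_finite gs.
- by move=> w _; rewrite lee_fin.
have := zero_list_fsum xpredT (fun=> 1) gs.
under eq_fsbigr do rewrite mulr1; move=> ->.
by rewrite big_const_seq count_predT iter_addr addr0.
Qed.

(** The powers r^n in the bounds on p and on h(0) cancel, leaving |p| <= (2M/|h(0)|) |p(0)|. Since p
    is zero-free only on the open disk, [zero_free_le] is applied at radius r/2, which turns its 4
    into 8. The zeros enter through |w - a| <= |a| (1 + |w|/|a|). *)
Lemma zero_list_upper h s r M w : zero_list h r s -> h 0 != 0 -> 0 < r ->
  (forall z, cmod z = 3 * r -> cmod (h z) <= M) -> cmod w <= r / 4 ->
  cmod (h w) <= cmod (h 0) * \prod_(a <- s) (1 + cmod w / cmod a) *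
     expR (8 * ln (4 * M / cmod (h 0)) * cmod w / r).
Proof.
move=> [p [ep hE sr hp]] h0 r0 hM wr.
have [h1 h2] := factor_bounds r0 hE sr hM.
have h00 : 0 < cmod (h 0) by rewrite cmod_gt0.
have rn0 : 0 < (2 * r) ^+ size s by rewrite exprn_gt0//; lra.
have r30 : 0 < 3 * r by lra.
have r20 : 0 < r / 2 by lra.
have hK z : cmod z <= r / 2 -> cmod (p z) <= 2 * M / cmod (h 0) * cmod (p 0).
  move=> zr.
  have h3 : cmod (p z) <= 2 * (M / (2 * r) ^+ size s).
    apply: (entire_disk_le ep r30) => [u ur|]; last by lra.
    by rewrite ler_pdivlMr// h1.
  rewrite mulrAC ler_pdivlMr//.
  apply: (le_trans (ler_wpM2l (cmod_ge0 _) h2)).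
  rewrite mulrA ler_wpM2r ?cmod_ge0//.
  apply: (le_trans (ler_wpM2r (exprn_ge0 _ (ltW r0)) h3)).
  have M0 : 0 <= M.
    have := entire0_le (r := 3 * r) (entire_mul_prod s ep) (ltW r30) (M := M).
    by move=> H; apply: le_trans (cmod_ge0 _) (H _) => z' z'r; rewrite -hE hM.
  rewrite -mulrA ler_pM2l// exprMn mulrAC ler_pdivrMr; last by rewrite mulr_gt0// exprn_gt0.
  rewrite ler_wpM2l// ler_peMl ?(exprn_ge0 _ (ltW r0))//.
  by rewrite -natrX ler1n expn_gt0.
have wr2 : cmod w <= r / 2 / 2 by lra.
have := @zero_free_le R p (r / 2) _ ep r20 _ hK w wr2.
have -> : 2 * (2 * M / cmod (h 0)) = 4 * M / cmod (h 0) by ring.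
have -> : 4 * ln (4 * M / cmod (h 0)) * cmod w / (r / 2) = 8 * ln (4 * M / cmod (h 0)) * cmod w / r.
  by field; lra.
move=> H; have {}H : cmod (p w) <= cmod (p 0) * expR (8 * ln (4 * M / cmod (h 0)) * cmod w / r).
  by apply: H => z zr; apply: hp; lra.
move: H; set E := expR _ => H; rewrite (hE w) (hE 0) cmodM.
apply: (le_trans (ler_wpM2l (cmod_ge0 _) H)).
rewrite mulrA ler_wpM2r /E ?expR_ge0// cmodM mulrAC ler_wpM2r ?cmod_ge0//.
rewrite !cmod_prod -big_split/= big_seq [leRHS]big_seq; apply: ler_prod => a as_.
rewrite cmod_ge0/= sub0r cmodN.
have a0 : 0 < cmod a.
  rewrite cmod_gt0; apply: contraNneq h0 => a0; rewrite hE (big_rem a)//= a0.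
  by rewrite subrr mul0r mul0r.
rewrite mulrDr mulr1 mulrCA divff ?mulr1 ?gt_eqF// (addrC (cmod a)); exact: cmodB.
Qed.

(* The zero-free cofactor of h on the disk of radius r is e^(o(r)) there, so its
   ratio to its value at 0 tends to 1 as r grows. *)
Lemma hadamard_le h w (B : R) : entire h -> h 0 != 0 ->
  (forall e, 0 < e -> exists r0, forall z, r0 <= cmod z -> cmod (h z) <= expR (e * cmod z)) ->
  (forall r s, 0 < r -> zero_list h r s -> \prod_(a <- s) (1 + cmod w / cmod a) <= B) ->
  cmod (h w) <= cmod (h 0) * B.
Proof.
move=> eh h0 hgrow hB.
have h00 : 0 < cmod (h 0) by rewrite cmod_gt0.
have w0 := cmod_ge0 w.
suff H d : 0 < d -> cmod (h w) <= cmod (h 0) * B * expR d.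
  rewrite leNgt; apply/negP => lt.
  have B0 : 0 <= cmod (h 0) * B.
    by have := le_trans (cmod_ge0 _) (H 1 ltr01); rewrite pmulr_lge0// expR_gt0.
  (* If x > y, this d contradicts x e^(-d) <= y, because e^(-d) >= 1 - d gives x e^(-d) >= (x +
     y)/2. *)
  pose x := cmod (h w); pose y := cmod (h 0) * B.
  have x0 : 0 < x by exact: le_lt_trans B0 lt.
  pose d := (x - y) / (2 * x).
  have d0 : 0 < d by rewrite divr_gt0// ?subr_gt0// mulr_gt0.
  have := H d d0; rewrite -/x -/y -ler_pdivrMr ?expR_gt0// -expRN.
  have := expR_ge1Dx (- d); have : d * (2 * x) = x - y by rewrite divfK// gt_eqF// mulr_gt0.
  move: (expR (- d)) => E dE Ed xE.
  have : x * (1 - d) <= x * E by rewrite ler_pM2l.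
  rewrite -/x -/y in lt; nra.
move=> d0.
(* The exponent is at most 8 (L + 3 e r) |w| / r. The 48 brings its part 24 e |w| below d/2, and the
   last term of [r] brings 8 L |w| / r below d/2. *)
pose e := d / (48 * (cmod w + 1)).
have cw : 0 < 48 * (cmod w + 1) by lra.
have e0 : 0 < e by rewrite divr_gt0.
have [r0 hr0] := hgrow e e0.
pose L := `|ln (4 / cmod (h 0))|.
pose r := 1 + `|r0| + 4 * cmod w + 16 * cmod w * L / d.
have L0 : 0 <= L by exact: normr_ge0.
have wL : 0 <= 16 * cmod w * L / d by rewrite !mulr_ge0// invr_ge0 ltW.
have r00 : r0 <= `|r0| by exact: ler_norm.
have nr0 : 0 <= `|r0| by [].
have r1 : 0 < r by rewrite /r; lra.
have [s hs] := zero_list_exists eh h0 r1.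
have hM z : cmod z = 3 * r -> cmod (h z) <= expR (e * (3 * r)).
  by move=> zr; rewrite -zr; apply: hr0; rewrite zr /r; lra.
have wr : cmod w <= r / 4 by rewrite /r; lra.
apply: (le_trans (zero_list_upper hs h0 r1 hM wr)).
have P0 : 0 <= \prod_(a <- s) (1 + cmod w / cmod a).
  by apply: prodr_ge0 => a _; rewrite addr_ge0// divr_ge0 ?cmod_ge0.
apply: ler_pM; rewrite ?expR_ge0//.
- by rewrite mulr_ge0// ltW.
- by rewrite ler_pM2l//; exact: hB hs.
rewrite ler_expR.
have -> : 4 * expR (e * (3 * r)) / cmod (h 0) = (4 / cmod (h 0)) * expR (e * (3 * r)) by ring.
rewrite lnM ?posrE ?expR_gt0 ?divr_gt0// expRK.
have lL : ln (4 / cmod (h 0)) <= L by exact: ler_norm.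
rewrite ler_pdivrMr//.
have er : e * (48 * (cmod w + 1)) = d by rewrite divfK// gt_eqF.
have dr : 16 * cmod w * L <= d * r.
  have : 16 * cmod w * L / d * d = 16 * cmod w * L by rewrite divfK// gt_eqF.
  have : 16 * cmod w * L / d <= r by rewrite /r; lra.
  move: (16 * cmod w * L / d) => y yr yd.
  by rewrite -yd mulrC ler_pM2l.
have k1 : 8 * ln (4 / cmod (h 0)) * cmod w <= 8 * L * cmod w by rewrite ler_wpM2r// ler_wpM2l.
have k2 : 24 * e * cmod w * r <= d / 2 * r by rewrite ler_wpM2r ?ltW//; nra.
nra.
Qed.

End Zeros.

(** * Dyadic sums *)

Section DyadicSums.
Variable R : realType.
Implicit Types (s : seq R) (c r t x y lam mu rho D : R).

Lemma exprn_powR x n mu : 0 <= x -> (x ^+ n) `^ mu = (x `^ mu) ^+ n.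
Proof. by move=> x0; rewrite -powR_mulrn// powRAC powR_mulrn// powR_ge0. Qed.

(** Each x is charged to one layer; counting everything below T j instead of the layer alone only
    enlarges the right side and lets counting bounds be inserted directly. *)
Lemma layer_sum_le s (phi : R -> R) J (T B : nat -> R) :
  (forall j, 0 <= B j) ->
  (forall x, x \in s -> exists2 j, (j < J)%N & x < T j /\ phi x <= B j) ->
  \sum_(x <- s) phi x <= \sum_(j < J) B j * (count (fun x => x < T j) s)%:R.
Proof.
move=> B0; elim: s => [|x s IH] H.
  by rewrite big_nil sumr_ge0// => j _; rewrite mulr_ge0.
rewrite big_cons /=.
under [leRHS]eq_bigr do rewrite natrD mulrDr.
rewrite big_split/= lerD//; last by apply: IH => y ys; apply: H; rewrite in_cons ys orbT.
have [j jJ [xT xB]] := H x (mem_head _ _).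
rewrite (bigD1 (Ordinal jJ))//= xT mulr1 ler_wpDr//.
by rewrite sumr_ge0// => i _; rewrite mulr_ge0.
Qed.

Lemma geom_sum_le (q : R) J : 0 <= q < 1 -> \sum_(j < J) q ^+ j <= (1 - q)^-1.
Proof.
move=> /andP[q0 q1]; have q10 : 0 < 1 - q by rewrite subr_gt0.
rewrite -[leRHS]mul1r ler_pdivlMr// mulrC -opprB mulNr -subrX1 opprB gerBl.
by rewrite exprn_ge0.
Qed.

Lemma two_powR_lt1 x : x < 0 -> 0 <= (2 : R) `^ x < 1.
Proof.
move=> x0; rewrite powR_ge0/= /powR pnatr_eq0/= expR_lt1 pmulr_llt0// ln_gt0//.
by rewrite ltr1n.
Qed.

Lemma dyadic_above c s : 0 < c -> exists J, forall x, x \in s -> c <= x ->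
  exists2 j, (j < J)%N & c * 2 ^+ j <= x < c * 2 ^+ j.+1.
Proof.
move=> c0; pose J := Num.bound ((\sum_(x <- s) `|x|) / c); exists J => x xs cx.
have S0 : 0 <= (\sum_(x <- s) `|x|) / c by rewrite divr_ge0 ?sumr_ge0// ltW.
have xJ : x < c * 2 ^+ J.
  rewrite mulrC -ltr_pdivrMr//.
  have xS : x / c <= (\sum_(x <- s) `|x|) / c.
    rewrite ler_pM2r ?invr_gt0// (le_trans (ler_norm x))// (big_rem x)//= lerDl.
    exact: sumr_ge0.
  apply: le_lt_trans xS _; apply: lt_trans (archi_boundP S0) _.
  by rewrite -natrX ltr_nat ltn_expl.
have ex : exists j, x < c * 2 ^+ j by exists J.
case: (ex_minnP ex) => -[|j] xj jmin; first by move: xj; rewrite expr0 mulr1 ltNge cx.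
exists j; first exact: jmin J xJ.
by rewrite xj andbT leNgt; apply/negP => /jmin; rewrite ltnn.
Qed.

(** The layer between c 2^j and c 2^(j+1) contributes at most (c 2^j)^(-lam) D (c 2^(j+1))^mu, a
    geometric series of ratio 2^(mu-lam) < 1. *)
Lemma sum_powR_le c s lam mu D : 0 < c -> 0 <= lam -> mu < lam -> 0 <= D ->
  all (fun x => c <= x) s ->
  (forall t, c <= t -> (count (fun x => x < t) s)%:R <= D * t `^ mu) ->
  \sum_(x <- s) x `^ (- lam) <= D * c `^ (mu - lam) * (2 `^ mu / (1 - 2 `^ (mu - lam))).
Proof.
move=> c0 lam0 ml D0 sc hD.
have [J hJ] := dyadic_above s c0.
pose B j := (c * 2 ^+ j) `^ (- lam); pose T j := c * 2 ^+ j.+1.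
have c2 j : 0 < c * 2 ^+ j by rewrite mulr_gt0// exprn_gt0.
have c2c j : c <= c * 2 ^+ j by rewrite ler_peMr ?(ltW c0)// -natrX ler1n expn_gt0.
apply: (@le_trans _ _ (\sum_(j < J) B j * (count (fun x => x < T j) s)%:R)).
  apply: layer_sum_le => [j|x xs]; first exact: powR_ge0.
  have [j jJ /andP[h1 h2]] := hJ x xs (allP sc x xs).
  exists j => //; split=> //; rewrite /B !powRN lef_pV2 ?posrE ?powR_gt0//.
    by rewrite ge0_ler_powR// nnegrE ltW// (lt_le_trans (c2 j)).
  exact: lt_le_trans (c2 j) h1.
have hq : 0 <= (2 : R) `^ (mu - lam) < 1 by apply: two_powR_lt1; lra.
apply: (@le_trans _ _ (\sum_(j < J) D * c `^ (mu - lam) * (2 `^ mu * (2 `^ (mu - lam)) ^+ j))).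
  apply: ler_sum => j _.
  apply: (le_trans (ler_wpM2l (powR_ge0 _ _) (hD (T j) (c2c _)))).
  rewrite /B /T !powRM ?exprn_ge0 ?(ltW c0)// !exprn_powR// exprS.
  rewrite !powRD ?(gt_eqF c0) ?pnatr_eq0 ?implybT// !exprMn.
  by rewrite le_eqVlt; apply/orP; left; apply/eqP; ring.
rewrite -mulr_sumr -mulr_sumr ler_wpM2l ?mulr_ge0 ?powR_ge0//.
by rewrite ler_wpM2l ?powR_ge0// geom_sum_le.
Qed.

(** For y <= 1, ln(1 + y) <= y <= y^lam. For y > 1, ln(1 + y) = ln(1 + 1/y) + ln y, where the first
    term is at most 1 and the second at most y^lam / lam. *)
Lemma ln1D_le_powR lam y : 0 < lam <= 1 -> 0 < y -> ln (1 + y) <= (1 + lam^-1) * y `^ lam.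
Proof.
move=> /andP[l0 l1] y0.
have p0 : 0 < y `^ lam by exact: powR_gt0.
have li : 0 < lam^-1 by rewrite invr_gt0.
have ln1y x : 0 < x -> ln (1 + x) <= x.
  move=> x0; rewrite -ler_expR lnK ?posrE ?addr_gt0//; exact: expR_ge1Dx.
have [y1|y1] := leP y 1.
  have : y <= y `^ lam by apply: ger1_powR => //; rewrite y0.
  by have := ln1y y y0; nra.
have -> : 1 + y = (1 + y^-1) * y by rewrite mulrDl mulVf ?gt_eqF// mul1r addrC.
rewrite lnM ?posrE ?addr_gt0 ?invr_gt0// mulrDl mul1r lerD//.
  apply: le_trans (ln1y _ _) _; first by rewrite invr_gt0.
  apply: (@le_trans _ _ 1); first by rewrite invf_le1// ltW.
  by rewrite -(powRr0 y) ler_powR// ltW.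
rewrite -ler_pdivrMl ?invr_gt0// invrK -ln_powR.
by apply: ltW; exact: ln_sublinear.
Qed.

(** K is chosen before the list, D and r, so the bound is linear in D. For x >= r the summand is at
    most r/x, and the exponent 1 exceeds rho. For x < r it is at most a constant times (r/x)^lam,
    and lam < rho makes the layers shrinking towards 0 summable. *)
Lemma sum_ln1D_le rho : 0 < rho < 1 -> exists2 K, 0 <= K &
  forall s D r, 0 < r -> 0 <= D -> all (fun x => 0 < x) s ->
  (forall t, 0 < t -> (count (fun x => x < t) s)%:R <= D * t `^ rho) ->
  \sum_(x <- s) ln (1 + r / x) <= K * (D * r `^ rho).
Proof.
move=> /andP[rho0 rho1].
pose K1 := (2 : R) `^ rho / (1 - 2 `^ (rho - 1)).
pose lam := rho / 2; have lam0 : 0 < lam by rewrite /lam; lra.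
pose K2 := (1 + lam^-1) * ((2 : R) `^ lam * 2 `^ rho / (1 - 2 `^ (lam - rho))).
have hq1 : 0 <= (2 : R) `^ (rho - 1) < 1 by apply: two_powR_lt1; lra.
have hq2 : 0 <= (2 : R) `^ (lam - rho) < 1 by apply: two_powR_lt1; rewrite /lam; lra.
have K10 : 0 <= K1 by rewrite divr_ge0 ?powR_ge0// subr_ge0; case/andP: hq1 => _ /ltW.
have lami : 0 < lam^-1 by rewrite invr_gt0.
have K20 : 0 <= K2.
  rewrite !mulr_ge0 ?powR_ge0 ?invr_ge0 ?subr_ge0//; first by lra.
  by case/andP: hq2 => _ /ltW.
exists (K1 + K2); first exact: addr_ge0.
move=> s D r r0 D0 s0 hD.
rewrite (bigID (fun x => r <= x))/= mulrDl lerD//.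
  rewrite -big_filter; set s1 := [seq x <- s | r <= x].
  have h1 : all (fun x => r <= x) s1 by exact: filter_all.
  have := @sum_powR_le r s1 1 rho D r0 ler01 rho1 D0 h1.
  rewrite -/K1 => H.
  apply: (@le_trans _ _ (r * \sum_(x <- s1) x `^ (- 1))).
    rewrite mulr_sumr big_seq [leRHS]big_seq; apply: ler_sum => x xs.
    have x0 : 0 < x by apply: lt_le_trans r0 (allP h1 x xs).
    rewrite (powR_inv1 (ltW x0)) -ler_expR lnK ?posrE ?addr_gt0 ?divr_gt0//.
    exact: expR_ge1Dx.
  have E : r * (D * r `^ (rho - 1) * K1) = K1 * (D * r `^ rho).
    by rewrite -(mulr_powRB1 (ltW r0) rho0); ring.
  rewrite -E ler_pM2l//; apply: H => t rt.
  apply: le_trans (hD t (lt_le_trans r0 rt)); rewrite ler_nat.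
  by rewrite /s1 count_filter; apply: sub_count => x /andP[].
under eq_bigl do rewrite -ltNge.
rewrite -big_filter; set s1 := [seq x <- s | x < r].
have h1 : all (fun x => x < r) s1 by exact: filter_all.
have h0 : all (fun x => 0 < x) s1 by apply/allP => x; rewrite mem_filter => /andP[_ /(allP s0)].
have [J hJ] := dyadic_above [seq r / x | x <- s1] ltr01.
(* In layer j, 2^j <= r/x only gives x <= r 2^-j; the factor 2 makes the inequality strict, as the
   count requires. *)
pose B j : R := (1 + lam^-1) * (2 ^+ j.+1) `^ lam; pose T j := 2 * r * 2^-1 ^+ j.
apply: (@le_trans _ _ (\sum_(j < J) B j * (count (fun x => x < T j) s1)%:R)).
  apply: layer_sum_le => [j|x xs]; first by rewrite mulr_ge0 ?powR_ge0//; lra.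
  have x0 := allP h0 x xs; have xr := allP h1 x xs.
  have [||j jJ /andP[]] := hJ (r / x).
  - exact: (map_f (fun x => r / x)).
  - by rewrite ler_pdivlMr// mul1r ltW.
  rewrite !mul1r => g1 g2; have j20 : 0 < (2 : R) ^+ j by rewrite exprn_gt0.
  exists j => //; split.
    rewrite /T exprVn ltr_pdivlMr//; move: g1; rewrite ler_pdivlMr// => g1.
    by rewrite mulrC; lra.
  have rx : 0 < r / x by rewrite divr_gt0.
  apply: (le_trans (@ln1D_le_powR lam _ _ rx)); first by rewrite lam0 /lam; lra.
  rewrite /B ler_wpM2l//; first by lra.
  by rewrite ge0_ler_powR ?nnegrE ?(ltW lam0) ?(ltW rx) ?exprn_ge0 ?(ltW g2).
have p2 : (2^-1 : R) `^ rho = 2 `^ (- rho).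
  by rewrite -[2^-1]powR_inv1// -powRrM mulN1r.
apply: (@le_trans _ _ (\sum_(j < J) (1 + lam^-1) * (2 `^ lam * 2 `^ rho) * (D * r `^ rho) * (2 `^ (lam - rho)) ^+ j)).
  apply: ler_sum => j _.
  have T0 : 0 < T j by rewrite /T !mulr_gt0// exprn_gt0.
  have cT : (count (fun x => x < T j) s1)%:R <= D * T j `^ rho.
    apply: le_trans (hD _ T0); rewrite ler_nat /s1 count_filter.
    by apply: sub_count => x /andP[].
  have B0 : 0 <= B j by rewrite mulr_ge0 ?powR_ge0//; lra.
  apply: (le_trans (ler_wpM2l B0 cT)).
  rewrite /B /T !powRM ?mulr_ge0 ?exprn_ge0 ?(ltW r0)// !exprn_powR// p2 exprS.
  rewrite !powRD ?pnatr_eq0 ?implybT// !exprMn.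
  by rewrite le_eqVlt; apply/orP; left; apply/eqP; ring.
rewrite -mulr_sumr.
have -> : K2 * (D * r `^ rho) = (1 + lam^-1) * (2 `^ lam * 2 `^ rho) * (D * r `^ rho) * (1 - 2 `^ (lam - rho))^-1.
  by rewrite /K2; ring.
rewrite ler_wpM2l ?geom_sum_le// !mulr_ge0 ?powR_ge0//; lra.
Qed.

Lemma powR_small mu nu (e : R) : mu < nu -> 0 < e ->
  exists2 r0, 1 <= r0 & forall r, r0 <= r -> r `^ mu <= e * r `^ nu.
Proof.
move=> mn e0; have d0 : 0 < nu - mu by rewrite subr_gt0.
exists (Num.max 1 ((e^-1) `^ (nu - mu)^-1)); first by rewrite le_max lexx.
move=> r; rewrite ge_max => /andP[r1 re].
have r0 : 0 < r by apply: lt_le_trans r1.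
have : e^-1 <= r `^ (nu - mu).
  have := @ge0_ler_powR R _ (ltW d0) _ _ _ _ re.
  rewrite -powRrM mulVf ?gt_eqF// powRr1 ?invr_ge0 ?(ltW e0)//; apply; rewrite nnegrE ?powR_ge0//.
  exact: ltW.
rewrite powRB; last by rewrite (gt_eqF r0) implybT.
rewrite ler_pdivlMr ?powR_gt0// => h.
by have := ler_wpM2l (ltW e0) h; rewrite mulrA mulfV ?gt_eqF// mul1r.
Qed.

End DyadicSums.

(** * Limits superior at infinity and comparison up to constants *)

Section LimSup.
Variable R : realType.
Implicit Types (F : R -> \bar R) (c : \bar R).

Lemma limf_esup_le F c : (exists r0, forall r, r0 < r -> (F r <= c)%E) ->
  (limf_esup F +oo%R <= c)%E.
Proof.
move=> [r0 h]; apply: ereal_inf_le; exists (ereal_sup [set F r | r in [set r | r0 < r]]).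
  by exists [set r | r0 < r] => //; exists r0; split; rewrite ?num_real.
by apply: ge_ereal_sup => _ [r /= rr <-]; exact: h.
Qed.

Lemma limf_esup_lt F c : (limf_esup F +oo%R < c)%E ->
  exists2 r0, 1 <= r0 & forall r, r0 < r -> (F r <= c)%E.
Proof.
move=> /ereal_inf_lt[_ [V [M [_ MV]] <-] hc].
exists (Num.max 1 M); first by rewrite le_max lexx.
move=> r; rewrite gt_max => /andP[_ Mr]; apply: le_trans (ltW hc).
by apply: ereal_sup_ubound; exists r => //; exact: MV.
Qed.

Lemma limf_esup_ge0_near F : (exists r0, forall r, r0 < r -> (0 <= F r)%E) ->
  (0 <= limf_esup F +oo%R)%E.
Proof.
move=> [r0 h]; apply: le_ereal_inf_tmp => _ [V [M [_ MV]] <-].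
pose r := Num.max r0 M + 1.
have [h1 h2] : r0 < r /\ M < r.
  by split; rewrite /r ltr_pwDr// le_max lexx ?orbT.
by apply: le_trans (h r h1) _; apply: ereal_sup_ubound; exists r => //; exact: MV.
Qed.

(** The hypotheses amount to y <= K x and x <= L y, phrased through finite strict upper bounds D
    because a bound on a limit superior is only usable near infinity after such a relaxation. *)
Lemma comparable_trichotomy (x y : \bar R) (K L : R) : (0 <= x)%E -> (0 <= y)%E ->
  0 < K -> 0 < L ->
  (forall D : R, 0 < D -> (x < D%:E)%E -> (y <= (K * D)%:E)%E) ->
  (forall D : R, 0 < D -> (y < D%:E)%E -> (x <= (L * D)%:E)%E) ->
  [/\ x = +oo%E <-> y = +oo%E, x = 0%E <-> y = 0%E &
      (0 < x < +oo)%E <-> (0 < y < +oo)%E].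
Proof.
move=> x0 y0 K0 L0.
have half (a b : \bar R) (k : R) : (0 <= a)%E -> (0 <= b)%E -> 0 < k ->
    (forall D : R, 0 < D -> (a < D%:E)%E -> (b <= (k * D)%:E)%E) ->
    (b = +oo%E -> a = +oo%E) /\ (a = 0%E -> b = 0%E).
  move=> a0 b0 k0 h; split.
    move=> bE; case: a a0 h => [a||]// a0 h; exfalso.
    have := h (a + 1); rewrite bE lte_fin ltrDl ltr01.
    rewrite lee_fin in a0; by move=> /(_ _ isT); rewrite leye_eq => H; have := H (ltr_wpDl a0 ltr01).
  move=> aE; apply/eqP; rewrite eq_le b0 andbT; apply/lee_addgt0Pr => e e0; rewrite add0e.
  have ek : 0 < e / k by rewrite divr_gt0.
  by have := h _ ek; rewrite aE lte_fin ek => /(_ isT); rewrite mulrC divfK ?gt_eqF.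
move=> /(half _ _ _ x0 y0 K0)[h1 h2] /(half _ _ _ y0 x0 L0)[h3 h4].
have fin (a : \bar R) : (0 <= a)%E -> (0 < a < +oo)%E <-> a <> 0%E /\ a <> +oo%E.
  move=> a0; split.
    by move=> /andP[a1 a2]; split=> aE; [move: a1|move: a2]; rewrite aE ltxx.
  move=> [/eqP a1 /eqP a2]; by rewrite lt_def a1 a0/= lt_neqAle a2 leey.
split; [by split|by split|].
rewrite !fin//; split=> -[p q]; split=> E.
- by apply: p; exact: h4.
- by apply: q; exact: h1.
- by apply: p; exact: h2.
- by apply: q; exact: h3.
Qed.

End LimSup.

(** * Growth of f against the distribution of an orbit *)

Section Orbit.
Variables (R : realType) (f : R[i] -> R[i]) (rho : R).
Local Notation C := R[i].

Lemma max_mod_ub w : entire f -> cmod (f w) <= max_mod f (cmod w).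
Proof.
move=> ef; have [B B0 hB] := entire_bounded (cmod w) ef.
apply: sup_ubound; last by exists w.
by exists B => _ [u /= ur <-]; apply: hB; rewrite ur.
Qed.

Lemma max_mod_le (r B : R) : 0 <= r ->
  (forall w, cmod w = r -> cmod (f w) <= B) -> max_mod f r <= B.
Proof.
move=> r0 h; apply: ge_sup.
  exists (cmod (f ((r%:C)%C))); exists ((r%:C)%C) => //.
  by rewrite /mkset cmod_real ger0_norm.
by move=> _ [w /= wr <-]; exact: h.
Qed.

(** A nonzero coefficient of positive index makes M(r) unbounded. The threshold e gives ln M >= 1,
    hence ln ln M >= 0. *)
Lemma max_mod_ge_exp1 : entire f -> (exists z1 z2, f z1 != f z2) ->
  exists2 r0, 1 <= r0 & forall r, r0 <= r -> expR 1 <= max_mod f r.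
Proof.
move=> ef [z1 [z2 f12]]; have [a af] := ef.
have [k ak] : exists k, a k.+1 != 0.
  apply/not_existsP => H; case/eqP: f12.
  suff E z : f z = a 0%N by rewrite !E.
  apply/eqP; rewrite -subr_eq0; apply/eqP/cmod_small_eq0 => e e0.
  have [N /(_ N.+1 (leqnSn _))] := af z e e0.
  rewrite /psum big_ord_recl big1 ?addr0 ?expr0 ?mulr1; first exact: ltW.
  by move=> i _; have := H i => /negP; rewrite negbK lift0 => /eqP ->; rewrite mul0r.
have ak0 : 0 < cmod (a k.+1) by rewrite cmod_gt0.
exists (Num.max 1 (expR 1 / cmod (a k.+1))); first by rewrite le_max lexx.
move=> r; rewrite ge_max => /andP[r1 re].
have r0 : 0 <= r by lra.
apply: (@le_trans _ _ (cmod (a k.+1) * r ^+ k.+1)).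
  apply: (@le_trans _ _ (cmod (a k.+1) * r)); first by rewrite mulrC -ler_pdivrMr.
  by rewrite ler_pM2l// exprS ler_peMr// exprn_ege1.
by apply: (cauchy_estimate af r0) => z zr; rewrite -zr; exact: max_mod_ub.
Qed.

Lemma max_mod_ln_le (r x : R) : ln (max_mod f r) <= x -> max_mod f r <= expR x.
Proof.
move=> h; have [M0|M0] := leP (max_mod f r) 0.
  by apply: (le_trans M0); exact: expR_ge0.
by rewrite -[leLHS]lnK// ler_expR.
Qed.

(** The factor 1 gives the bound the same shape D r^mu as [type_max_mod], so that [zero_count_le]
    serves both. *)
Lemma order_max_mod mu : (forder f < mu%:E)%E ->
  exists2 r0, 1 <= r0 & forall r, r0 < r -> max_mod f r <= expR (1 * r `^ mu).
Proof.
move=> /limf_esup_lt[r0 r01 h]; exists r0 => // r rr; rewrite mul1r.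
apply: max_mod_ln_le; have := h r rr; rewrite lee_fin.
have lr : 0 < ln r by apply: ln_gt0; lra.
(* For ln M <= 0 the outer logarithm takes its default value 0 and carries no information. *)
rewrite ler_pdivrMr//; have [l0 _|l0] := leP (ln (max_mod f r)) 0.
  by apply: (le_trans l0); exact: powR_ge0.
have r0' : 0 < r by lra.
have -> : r `^ mu = expR (mu * ln r) by rewrite /powR (gt_eqF r0').
by move=> H; rewrite -[leLHS]lnK// ler_expR.
Qed.

Lemma type_max_mod (D : R) : (ftype f rho < D%:E)%E ->
  exists2 r0, 1 <= r0 & forall r, r0 < r -> max_mod f r <= expR (D * r `^ rho).
Proof.
move=> /limf_esup_lt[r0 r01 h]; exists r0 => // r rr.
apply: max_mod_ln_le; have := h r rr; rewrite lee_fin ler_pdivrMr// powR_gt0//; lra.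
Qed.

Hypothesis ef : entire f.
Hypothesis nf : exists z1 z2, f z1 != f z2.
Hypothesis fo : forder f = rho%:E.
Hypothesis rho1 : rho < 1.

Lemma order_ge0 : 0 <= rho.
Proof.
rewrite -lee_fin -fo; apply: limf_esup_ge0_near.
have [r0 r01 h] := max_mod_ge_exp1 ef nf; exists r0 => r rr.
rewrite lee_fin divr_ge0//; last by apply: ln_ge0; lra.
have hM := h r (ltW rr); have M0 := lt_le_trans (expR_gt0 1) hM.
by apply: ln_ge0; rewrite -[leLHS]expRK ler_ln// posrE expR_gt0.
Qed.

Lemma ftype_ge0 : (0 <= ftype f rho)%E.
Proof.
apply: limf_esup_ge0_near.
have [r0 r01 h] := max_mod_ge_exp1 ef nf; exists r0 => r rr.
rewrite lee_fin divr_ge0 ?powR_ge0//; apply: ln_ge0; apply: le_trans (h r (ltW rr)).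
by rewrite -expR0 ler_expR.
Qed.

Variables (z : C) (m : nat) (h : C -> C).
Hypothesis eh : entire h.
Hypothesis h0 : h 0 != 0.
Hypothesis hE : forall u, f u - f z = u ^+ m * h u.

Let g := orbit_fun f z.

Let h00 : 0 < cmod (h 0). Proof. by rewrite cmod_gt0. Qed.

Lemma orbit_zero_list r s : 0 < r -> zero_list h r s -> zero_list g r (nseq m 0 ++ s).
Proof.
move=> r0 hs; rewrite (_ : g = (fun u => u ^+ m * h u)); first exact: zero_list_mulX.
by apply/funext => u; rewrite -hE.
Qed.

Lemma quotient_le (r B : R) w : 1 <= r -> cmod w = r -> max_mod f r <= expR B -> 0 <= B ->
  cmod (h w) <= (1 + cmod (f z)) * expR B.
Proof.
move=> r1 wr hB B0.
have : cmod (w ^+ m * h w) <= expR B + cmod (f z).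
  rewrite -hE (le_trans (cmodB _ _))// lerD2r (le_trans _ hB)// -wr.
  exact: max_mod_ub.
have eB : 1 <= expR B by rewrite -expR0 ler_expR.
rewrite cmodM cmodX wr => hh.
have : cmod (h w) <= r ^+ m * cmod (h w) by rewrite ler_peMl ?cmod_ge0// exprn_ege1.
by have := cmod_ge0 (f z); nra.
Qed.

Lemma zero_count_le : exists2 C0, 0 <= C0 & forall (r D mu : R) s, 1 <= r -> 0 <= D ->
  max_mod f (3 * r) <= expR (D * (3 * r) `^ mu) -> zero_list h r s ->
  (size s)%:R <= 2 * (D * (3 * r) `^ mu) + C0.
Proof.
pose L := ln ((1 + cmod (f z)) / cmod (h 0)).
exists (2 * `|L|); first by rewrite mulr_ge0.
move=> r D mu s r1 D0 hB [p [ep hpE sr _]].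
have r0 : 0 < r by lra.
have B0 : 0 <= D * (3 * r) `^ mu by rewrite mulr_ge0 ?powR_ge0.
have r31 : 1 <= 3 * r by lra.
have := factor_size r0 ep hpE sr (fun w wr => quotient_le r31 wr hB B0).
rewrite -ler_pdivlMr// mulrAC => H.
(* From e^(-1/2) >= 1 - 1/2; this is the origin of the factor 2 in the conclusion. *)
have ln2 : 2^-1 <= ln 2 :> R.
  rewrite -ler_expR lnK ?posrE//.
  have := expR_ge1Dx (- 2^-1 : R); rewrite expRN.
  rewrite -[leRHS]mul1r ler_pdivlMr ?expR_gt0// => E.
  by lra.
have c1 : 0 < 1 + cmod (f z) by have := cmod_ge0 (f z); lra.
have : ln (2 ^+ size s) <= L + D * (3 * r) `^ mu.
  rewrite -[X in L + X]expRK -lnM ?posrE ?divr_gt0 ?expR_gt0//.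
  by rewrite ler_ln ?posrE ?exprn_gt0// ?mulr_gt0 ?invr_gt0 ?expR_gt0.
rewrite lnXn// -[ln 2 *+ _]mulr_natl => H2.
have := ler_norm L; have : (size s)%:R * 2^-1 <= (size s)%:R * ln 2 :> R by rewrite ler_wpM2l.
by lra.
Qed.

(** One c serves all radii, because only the finitely many zeros in the unit disk can come closer to
    0 than 1. *)
Lemma zeros_away0 : exists2 c, 0 < c & forall r s, zero_list h r s -> all (fun a => c <= cmod a) s.
Proof.
have [s1 hs1] := zero_list_exists eh h0 ltr01.
have s1n0 : all (fun a => 0 < cmod a) s1.
  apply/allP => a as1; rewrite cmod_gt0; apply: contraNneq h0 => a0.
  rewrite (zero_list_mem hs1) ?cmod0//; by rewrite -a0.
have [c c0 hc] : exists2 c, 0 < c & all (fun a => c <= cmod a) s1.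
  elim: s1 s1n0 {hs1} => [_|a t IH /= /andP[a0 /IH[c c0 hc]]]; first by exists 1.
  exists (Num.min (cmod a) c); first by rewrite lt_min a0.
  by rewrite ge_min lexx/=; apply: sub_all hc => b cb; rewrite ge_min cb orbT.
exists (Num.min 1 c); first by rewrite lt_min ltr01.
move=> r s hs; apply/allP => a as_; rewrite ge_min.
have [//|a1] := leP 1 (cmod a); rewrite orbC.
have := zero_list_mem hs (allP (zero_list_lt hs) a as_); rewrite as_.
by rewrite (zero_list_mem hs1 a1) => /(allP hc) ->.
Qed.

Lemma zero_list_count_le r t s st : zero_list h r s -> zero_list h t st ->
  (count (fun a => (cmod a < t)%R) s <= size st)%N.
Proof.
move=> hs ht; have [tr|/ltW rt] := leP t r.
  by rewrite (perm_size (zero_list_perm ht hs tr)) size_filter.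
apply: leq_trans (count_size _ _) _.
by rewrite (perm_size (zero_list_perm hs ht rt)) size_filter count_size.
Qed.

Lemma h_subexponential e : 0 < e ->
  exists r0, forall w, r0 <= cmod w -> cmod (h w) <= expR (e * cmod w).
Proof.
(* An exponent strictly between the order and 1, so that r^mu = o(r). *)
move=> e0; pose mu := (rho + 1) / 2.
have mu0 : 0 <= mu by have := order_ge0; rewrite /mu; lra.
have mu1 : mu < 1 by have := rho1; rewrite /mu; lra.
have [|r1 r11 hr1] := @order_max_mod mu; first by have := rho1; rewrite fo lte_fin /mu; lra.
have e20 : 0 < e / 2 by lra.
have [r2 r21 hr2] := powR_small mu1 e20.
pose L := ln (1 + cmod (f z)).
have c1 : 0 < 1 + cmod (f z) by have := cmod_ge0 (f z); lra.
have L0 : 0 <= L by apply: ln_ge0; have := cmod_ge0 (f z); lra.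
exists (r1 + 1 + r2 + 2 * L / e) => w wr.
have Le : 0 <= 2 * L / e by rewrite divr_ge0 ?(ltW e0)// mulr_ge0.
have w1 : 1 <= cmod w by lra.
have w0 : 0 <= cmod w by lra.
have B0 : 0 <= 1 * cmod w `^ mu by rewrite mul1r powR_ge0.
apply: (le_trans (quotient_le w1 erefl (hr1 _ _) B0)); first by lra.
rewrite -[1 + _]lnK// -/L -expRD ler_expR mul1r.
have := hr2 (cmod w); rewrite powRr1//.
have : 2 * L <= e * cmod w by rewrite -ler_pdivrMl// mulrC; lra.
have r2w : r2 <= cmod w by lra.
by move=> H1 /(_ r2w); lra.
Qed.

(** [hadamard_le] after taking logarithms. The term m ln r is the zero at the origin; C1 collects
    |f(z)| and |h(0)| and does not depend on r or E. *)
Lemma max_mod_le_zeros : exists2 C1, 0 <= C1 & forall (r E : R), 1 <= r -> 0 <= E ->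
  (forall t s, 0 < t -> zero_list h t s -> \sum_(a <- s) ln (1 + r / cmod a) <= E) ->
  ln (max_mod f r) <= E + m%:R * ln r + C1.
Proof.
pose A := 1 + cmod (f z) + cmod (h 0).
have f0 := cmod_ge0 (f z).
have A1 : 1 <= A by have := h00; rewrite /A; lra.
exists (ln A); first exact: ln_ge0.
move=> r E r1 E0 hs.
have r0 : 0 < r by lra.
have rm : 1 <= r ^+ m by rewrite exprn_ege1.
have eE : 1 <= expR E by rewrite -expR0 ler_expR.
have hM : max_mod f r <= A * r ^+ m * expR E.
  apply: max_mod_le; first exact: ltW.
  move=> w wr.
  have : cmod (h w) <= cmod (h 0) * expR E.
    apply: (hadamard_le eh h0 h_subexponential) => t s t0 ts; rewrite wr.
    apply: (@le_trans _ _ (expR (\sum_(a <- s) ln (1 + r / cmod a)))).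
      rewrite expR_sum le_eqVlt; apply/orP; left; apply/eqP; apply: eq_bigr => a _.
      by rewrite lnK// posrE ltr_pwDl// divr_ge0 ?cmod_ge0// ltW.
    by rewrite ler_expR; exact: hs ts.
  have -> : f w = f z + w ^+ m * h w by rewrite -hE addrC subrK.
  move=> hw; rewrite (le_trans (cmodD _ _))// cmodM cmodX wr.
  have : r ^+ m * cmod (h w) <= r ^+ m * (cmod (h 0) * expR E) by rewrite ler_wpM2l//; lra.
  have : 1 <= r ^+ m * expR E by rewrite mulr_ege1.
  have : A * r ^+ m * expR E = r ^+ m * expR E + cmod (f z) * (r ^+ m * expR E) + r ^+ m * (cmod (h 0) * expR E).
    by rewrite /A; ring.
  nra.
have [M0|M0] := leP (max_mod f r) 0.
  by rewrite ln0// !addr_ge0// ?mulr_ge0 ?ln_ge0.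
have -> : E + m%:R * ln r + ln A = ln (A * r ^+ m * expR E).
  rewrite !lnM ?posrE ?expR_gt0 ?mulr_gt0 ?exprn_gt0//; try lra.
  by rewrite expRK lnXn// -mulr_natl; lra.
by rewrite ler_ln// posrE !mulr_gt0 ?expR_gt0 ?exprn_gt0//; lra.
Qed.

Lemma ln_le_powR (lam r : R) : 0 < lam -> 0 < r -> ln r <= lam^-1 * r `^ lam.
Proof.
move=> l0 r0; rewrite ler_pdivlMl// -ln_powR; apply: ltW.
by apply: ln_sublinear; exact: powR_gt0.
Qed.

Lemma sum_list_cmod (phi : R -> R) (s : seq C) :
  \sum_(a <- s) phi (cmod a) = \sum_(x <- [seq cmod a | a <- s]) phi x.
Proof. by rewrite big_map. Qed.

(** * The convergence exponent equals the order *)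

Lemma conv_exponent_le lam : rho < lam ->
  exists2 B : R, 0 <= B & forall t s, 0 < t -> zero_list h t s ->
    \sum_(a <- s) cmod a `^ (- lam) <= B.
Proof.
move=> rl; have rho0 := order_ge0.
pose mu := (rho + lam) / 2.
have mu0 : 0 < mu by rewrite /mu; lra.
have ml : mu < lam by rewrite /mu; lra.
have [|r1 r11 hr1] := @order_max_mod mu; first by rewrite fo lte_fin /mu; lra.
have [C0 C00 hC0] := zero_count_le.
have [c c0 hc] := zeros_away0.
have r10 : 0 < r1 + 1 by lra.
have [s0 hs0] := zero_list_exists eh h0 r10.
(* The order controls the count only beyond r1; below, the count is at most the length of [s0]. As y
   >= c, dividing by c^mu lets constants be absorbed into D y^mu. *)
pose D := 2 * 3 `^ mu + (C0 + (size s0)%:R) / c `^ mu.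
have cm0 : 0 < c `^ mu by exact: powR_gt0.
have D0 : 0 <= D by rewrite addr_ge0// ?mulr_ge0 ?powR_ge0 ?invr_ge0 ?powR_ge0 ?addr_ge0.
exists (D * c `^ (mu - lam) * (2 `^ mu / (1 - 2 `^ (mu - lam)))).
  rewrite !mulr_ge0 ?powR_ge0// invr_ge0 subr_ge0.
  have ml0 : mu - lam < 0 by lra.
  by case/andP: (two_powR_lt1 ml0) => _ /ltW.
move=> t s t0 ts; rewrite (sum_list_cmod (fun x => x `^ (- lam))).
apply: sum_powR_le => //; first by lra.
  by rewrite all_map; exact: hc ts.
move=> y cy; rewrite count_map.
have y0 : 0 < y by lra.
have cy' : c `^ mu <= y `^ mu by rewrite ge0_ler_powR// ?nnegrE; lra.
have key : C0 + (size s0)%:R <= (C0 + (size s0)%:R) / c `^ mu * y `^ mu.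
  by rewrite mulrAC ler_pdivlMr// ler_wpM2l// addr_ge0.
have ym := powR_ge0 y mu; have p3 := powR_ge0 (3 : R) mu.
have n0 : 0 <= (size s0)%:R :> R by [].
rewrite /D mulrDl; have [yr|yr] := leP y (r1 + 1).
  have : (count (fun a => (cmod a < y)%R) s <= size s0)%N.
    apply: leq_trans (zero_list_count_le ts hs0); apply: sub_count => a /= ay.
    exact: lt_le_trans ay yr.
  rewrite -(ler_nat R) => H; apply: (le_trans H).
  have : 0 <= 2 * 3 `^ mu * y `^ mu by rewrite !mulr_ge0.
  by lra.
have [sy hsy] := zero_list_exists eh h0 y0.
have : (count (fun a => (cmod a < y)%R) s)%:R <= (size sy)%:R :> R.
  by rewrite ler_nat; exact: zero_list_count_le ts hsy.
have y1 : 1 <= y by lra.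
have := hC0 y 1 mu sy y1 ler01 (hr1 _ _) hsy.
rewrite mul1r powRM ?(ltW y0)// => /(_ ltac:(lra)).
by lra.
Qed.

(** Applying [ln1D_le_powR] to each zero bounds the sum of logarithms by a multiple of B r^lam, so
    ln M = O(r^lam). *)
Lemma order_le_of_sum (lam B : R) : 0 < lam <= 1 -> 0 <= B ->
  (forall t s, 0 < t -> zero_list h t s -> \sum_(a <- s) cmod a `^ (- lam) <= B) ->
  rho <= lam.
Proof.
move=> l01 B0 hB; have /andP[l0 l1] := l01.
have li : 0 < lam^-1 by rewrite invr_gt0.
have [C1 C10 hC1] := max_mod_le_zeros.
apply: le_of_eps => e e0; rewrite -lee_fin -fo.
pose K := (1 + lam^-1) * B + m%:R * lam^-1 + C1.
have K0 : 0 <= K by rewrite !addr_ge0// mulr_ge0//; lra.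
have Ki : 0 < (K + 1)^-1 by rewrite invr_gt0; lra.
have le' : lam < lam + e by lra.
have [r1 r11 hr1] := powR_small le' Ki.
apply: limf_esup_le; exists r1 => r rr.
have r1' : 1 < r by lra.
have r0 : 0 < r by lra.
have lr : 0 < ln r by exact: ln_gt0.
rewrite lee_fin ler_pdivrMr//.
have hl : ln (max_mod f r) <= r `^ (lam + e).
  apply: (@le_trans _ _ (K * r `^ lam)); last first.
    have := hr1 r (ltW rr); rewrite mulrC ler_pdivlMr; last by lra.
    by have := powR_ge0 r lam; nra.
  have E0 : 0 <= (1 + lam^-1) * B * r `^ lam by rewrite !mulr_ge0 ?powR_ge0//; lra.
  apply: (le_trans (hC1 r ((1 + lam^-1) * B * r `^ lam) (ltW r1') E0 _)).
    move=> t s t0 ts; rewrite -mulrA [B * _]mulrC mulrA.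
    apply: (@le_trans _ _ (\sum_(a <- s) (1 + lam^-1) * r `^ lam * cmod a `^ (- lam))).
      rewrite big_seq [leRHS]big_seq; apply: ler_sum => a as_.
      have [c c0 hc] := zeros_away0.
      have a0 : 0 < cmod a by apply: lt_le_trans c0 (allP (hc _ _ ts) a as_).
      apply: le_trans (ln1D_le_powR l01 (divr_gt0 r0 a0)) _.
      rewrite -mulrA ler_wpM2l//; first by lra.
      by rewrite powRM ?invr_ge0 ?(ltW r0) ?(ltW a0)// -powR_inv1 ?(ltW a0)// -powRrM mulN1r.
    rewrite -mulr_sumr ler_wpM2l ?mulr_ge0 ?powR_ge0//; first by lra.
    exact: hB ts.
  have := ln_le_powR l0 r0; have p1 : 1 <= r `^ lam by rewrite -(powRr0 r) ler_powR// ltW.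
  move=> H; have := ler_wpM2l (ler0n R m) H; rewrite /K.
  have : C1 <= C1 * r `^ lam by rewrite ler_peMr.
  by lra.
have [l0'|l0'] := leP (ln (max_mod f r)) 0.
  by rewrite ln0// mulr_ge0 ?(ltW lr)//; lra.
by rewrite -ln_powR ler_ln// posrE powR_gt0.
Qed.

Lemma conv_exponentE : conv_exponent f z = rho%:E.
Proof.
have rho0 := order_ge0.
have Q s : all (fun a => a != 0) s -> forall phi : C -> R,
    \sum_(a <- nseq m 0 ++ s | a != 0) phi a = \sum_(a <- s) phi a.
  move=> s0 phi; rewrite big_cat/= big_nseq_cond eqxx/= add0r big_seq_cond [RHS]big_seq.
  by apply: eq_bigl => a; case: (boolP (a \in s)) => // /(allP s0) ->.
have s0 t s : zero_list h t s -> all (fun a => a != 0) s.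
  have [c c0 hc] := zeros_away0 => /hc; apply: sub_all => a ca.
  by rewrite -cmod_gt0 (lt_le_trans c0).
apply/eqP; rewrite eq_le; apply/andP; split.
  apply/lee_addgt0Pr => e e0; rewrite -EFinD.
  apply: ereal_inf_lbound; exists (rho + e) => //; split; first by lra.
  have [|B B0 hB] := @conv_exponent_le (rho + e); first by lra.
  apply: (@le_lt_trans _ _ B%:E); last exact: ltry.
  apply: (@zero_list_esum_le R g (fun w => w != 0) (fun w => cmod w `^ (- (rho + e)))).
    by move=> w; exact: powR_ge0.
  move=> r r0; have [s hs] := zero_list_exists eh h0 r0.
  exists (nseq m 0 ++ s); split; first exact: orbit_zero_list.
  by rewrite Q ?(s0 _ _ hs)//; exact: hB hs.
apply: le_ereal_inf_tmp => _ [lam [l0 hl] <-]; rewrite lee_fin.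
(* For lam >= 1 the inequality is immediate from rho < 1; the rest satisfies the condition lam <= 1
   of [order_le_of_sum]. *)
have [l1|/ltW l1] := leP 1 lam; first by have := rho1; lra.
set S := esum _ _ in hl.
have S0 : (0 <= S)%E.
  by apply: esum_ge0 => w _; rewrite lee_fin mulr_ge0 ?powR_ge0.
have Sf : S = (fine S)%:E by rewrite fineK// ge0_fin_numE.
apply: (@order_le_of_sum lam (fine S)); rewrite ?l0 ?fine_ge0//.
move=> t s t0 ts; rewrite -lee_fin -Sf -(Q _ (s0 _ _ ts)).
exact: (zero_list_esum_ge (fun w => w != 0) _ (orbit_zero_list t0 ts)).
Qed.

(** * The type against the upper density of the orbit *)

Lemma upper_density_ge0 : (0 <= upper_density f z rho)%E.
Proof.
apply: limf_esup_ge0_near; exists 0 => r _; rewrite mule_ge0//.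
  by apply: esum_ge0 => w _; rewrite lee_fin.
by rewrite lee_fin invr_ge0 powR_ge0.
Qed.

Lemma orbit_countE r s : 0 < r -> zero_list h r s ->
  orbit_count f z r = ((m + size s)%:R%:E)%E.
Proof.
by move=> r0 hs; rewrite (orbit_count_size (orbit_zero_list r0 hs)) size_cat size_nseq.
Qed.

Lemma ftype_le_upper_density : 0 < rho -> exists2 K : R, 0 < K &
  forall D : R, 0 < D -> (upper_density f z rho < D%:E)%E -> (ftype f rho <= (K * D)%:E)%E.
Proof.
move=> rho0; have rho01 : 0 < rho < 1 by rewrite rho0 rho1.
have [K0 K00 hK0] := sum_ln1D_le rho01.
(* K0 D r^rho comes from the zeros far out; the added 1 pays for all terms of lower order. *)
exists (K0 + 1); first by lra.
move=> D D0 /limf_esup_lt[r1 r11 hr1].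
have hn t s : r1 < t -> zero_list h t s -> (size s)%:R <= D * t `^ rho.
  move=> rt ts; have t0 : 0 < t by lra.
  have := hr1 t rt; rewrite (orbit_countE t0 ts) -EFinM lee_fin ler_pdivrMr ?powR_gt0//.
  by apply: le_trans; rewrite ler_nat leq_addl.
have [c c0 hc] := zeros_away0.
have [C1 C10 hC1] := max_mod_le_zeros.
have r10 : 0 < r1 + 1 by lra.
have [s0 hs0] := zero_list_exists eh h0 r10.
pose n0 : R := (size s0)%:R.
have n00 : 0 <= n0 by rewrite /n0.
pose lam := rho / 2; have lam0 : 0 < lam by rewrite /lam; lra.
have l01 : 0 < lam <= 1 by rewrite lam0 /lam; have := rho1; lra.
have li : 0 < lam^-1 by rewrite invr_gt0.
(* Everything of lower order is at most Q r^(rho/2): the finitely many small zeros, the zero at the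
   origin, and the constant. *)
pose Q := n0 * ((1 + lam^-1) * c^-1 `^ lam) + m%:R * lam^-1 + C1.
have Q0 : 0 <= Q.
  by rewrite !addr_ge0// ?mulr_ge0 ?powR_ge0//; lra.
have lr' : lam < rho by rewrite /lam; lra.
have e0 : 0 < D / (Q + 1) by rewrite divr_gt0//; lra.
have [r2 r21 hr2] := powR_small lr' e0.
apply: limf_esup_le; exists r2 => r rr.
have r0 : 0 < r by lra.
have rl1 : 1 <= r by lra.
rewrite lee_fin ler_pdivrMr ?powR_gt0//.
have lc0 : 0 <= ln (1 + r / c) by apply: ln_ge0; rewrite lerDl divr_ge0// ltW.
have rp := powR_ge0 r rho.
have E0 : 0 <= n0 * ln (1 + r / c) + K0 * (D * r `^ rho).
  by rewrite addr_ge0// !mulr_ge0// ltW.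
apply: (le_trans (hC1 r _ rl1 E0 _)).
  move=> t s t0 ts.
  (* The density bound holds only beyond r1, while [sum_ln1D_le] needs it at every y > 0. With the
     small zeros removed the count below r1 + 1 is zero, so it does hold everywhere. *)
  rewrite (bigID (fun a => cmod a < r1 + 1))/=; apply: lerD.
    apply: (@le_trans _ _ (\sum_(a <- s | cmod a < r1 + 1) ln (1 + r / c))).
      rewrite big_seq_cond [leRHS]big_seq_cond; apply: ler_sum => a /andP[as_ _].
      have ca := allP (hc _ _ ts) a as_; have a0 := lt_le_trans c0 ca.
      rewrite ler_ln ?posrE ?ltr_pwDl ?divr_ge0 ?(ltW r0) ?(ltW c0) ?(ltW a0)//.
      by rewrite lerD2l ler_pM2l// lef_pV2.
    rewrite big_const_seq iter_addr addr0 -mulr_natl ler_wpM2r// /n0 ler_nat.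
    exact: zero_list_count_le ts hs0.
  under eq_bigl do rewrite -leNgt.
  rewrite -big_filter (sum_list_cmod (fun x => ln (1 + r / x))).
  apply: hK0 => //; first exact: ltW.
    rewrite all_map; apply/allP => a; rewrite mem_filter => /andP[/= ra _]; lra.
  move=> y y0; rewrite count_map count_filter /=.
  have [yr|yr] := leP y (r1 + 1).
    rewrite (eq_count (a2 := pred0)) ?count_pred0 ?mulr_ge0 ?powR_ge0 ?(ltW D0)//.
    by move=> a /=; apply/negP => /andP[ay ra]; lra.
  have [sy hsy] := zero_list_exists eh h0 y0.
  apply: le_trans (hn y sy _ hsy); last by lra.
  rewrite ler_nat; apply: leq_trans (zero_list_count_le ts hsy).
  by apply: sub_count => a /andP[].
have h1 := hr2 r (ltW rr).
have p1 : 1 <= r `^ lam by rewrite -(powRr0 r) ler_powR// ltW.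
have h2 : ln (1 + r / c) <= (1 + lam^-1) * c^-1 `^ lam * r `^ lam.
  apply: le_trans (ln1D_le_powR l01 (divr_gt0 r0 c0)) _.
  by rewrite powRM ?invr_ge0 ?(ltW r0) ?(ltW c0)// mulrCA mulrC.
have h3 := ler_wpM2l (ler0n R m) (ln_le_powR lam0 r0).
have h4 := ler_wpM2l n00 h2.
have h5 : C1 <= C1 * r `^ lam by rewrite ler_peMr.
have h6 : Q * r `^ lam <= D * r `^ rho.
  move: h1; rewrite mulrAC ler_pdivlMr; last by lra.
  by have := powR_ge0 r lam; nra.
by move: h6; rewrite /Q; lra.
Qed.

Lemma upper_density_le_ftype : 0 < rho -> exists2 L : R, 0 < L &
  forall D : R, 0 < D -> (ftype f rho < D%:E)%E -> (upper_density f z rho <= (L * D)%:E)%E.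
Proof.
move=> rho0; have [C0 C00 hC0] := zero_count_le.
have p3 := powR_ge0 (3 : R) rho.
(* The count at r is bounded by 2 D (3r)^rho plus a constant; the added 1 absorbs m + C0, which is
   o(r^rho) as rho > 0. *)
exists (2 * 3 `^ rho + 1); first by lra.
move=> D D0 /type_max_mod[r1 r11 hr1].
have m0 : 0 <= m%:R :> R by [].
have e0 : 0 < D / (m%:R + C0 + 1) by rewrite divr_gt0//; lra.
have [r2 r21 hr2] := powR_small rho0 e0.
apply: limf_esup_le; exists (r1 + r2) => r rr.
have r0 : 0 < r by lra.
have rl1 : 1 <= r by lra.
have [s hs] := zero_list_exists eh h0 r0.
rewrite (orbit_countE r0 hs) -EFinM lee_fin ler_pdivrMr ?powR_gt0// natrD.
have hM : max_mod f (3 * r) <= expR (D * (3 * r) `^ rho) by apply: hr1; lra.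
have := hC0 r D rho s rl1 (ltW D0) hM hs.
rewrite powRM ?(ltW r0)//.
have := hr2 r; rewrite powRr0 mulrAC ler_pdivlMr; last by lra.
have rr2 : r2 <= r by lra.
by move=> /(_ rr2); lra.
Qed.

Lemma ftype_upper_density : rho != 0 ->
  [/\ ftype f rho = +oo%E <-> upper_density f z rho = +oo%E,
      ftype f rho = 0%E <-> upper_density f z rho = 0%E &
      ((0 < ftype f rho < +oo)%E <-> (0 < upper_density f z rho < +oo)%E)].
Proof.
move=> rhon0; have rho0 : 0 < rho by rewrite lt_def rhon0 order_ge0.
have [K K0 hK] := ftype_le_upper_density rho0.
have [L L0 hL] := upper_density_le_ftype rho0.
exact: comparable_trichotomy ftype_ge0 upper_density_ge0 L0 K0 hL hK.
Qed.

End Orbit.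

Theorem theorem9 (R : realType) (f : R[i] -> R[i]) (rho : R) :
  entire f ->
  (exists z1 z2 : R[i], f z1 != f z2) ->
  forder f = rho%:E ->
  rho < 1 ->
  (forall z : R[i], conv_exponent f z = rho%:E) /\
  (rho != 0 ->
    (forall z : R[i],
      [/\ ftype f rho = +oo%E <-> upper_density f z rho = +oo%E,
          ftype f rho = 0%E <-> upper_density f z rho = 0%E &
          ((0 < ftype f rho < +oo)%E <-> (0 < upper_density f z rho < +oo)%E)]) /\
    (forall z z' : R[i],
      [/\ upper_density f z rho = +oo%E <-> upper_density f z' rho = +oo%E,
          upper_density f z rho = 0%E <-> upper_density f z' rho = 0%E &
          ((0 < upper_density f z rho < +oo)%E <->
             (0 < upper_density f z' rho < +oo)%E)])).
Proof.
move=> ef nf fo rho1.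
have fac z : exists m h, [/\ entire h, h 0 != 0 & forall u, f u - f z = u ^+ m * h u].
  apply: (@entire_factor0 R (fun u => f u - f z)); first exact: entire_subC.
  (* At least one of two distinct values differs from f(z), so f - f(z) is not identically zero. *)
  have [z1 [z2 f12]] := nf; have [E|] := eqVneq (f z1) (f z).
    by exists z2; rewrite subr_eq0 -E eq_sym.
  by exists z1; rewrite subr_eq0.
split=> [z|rho0].
  by have [m [h [eh h0 hE]]] := fac z; exact: conv_exponentE hE.
have type z : [/\ ftype f rho = +oo%E <-> upper_density f z rho = +oo%E,
    ftype f rho = 0%E <-> upper_density f z rho = 0%E &
    ((0 < ftype f rho < +oo)%E <-> (0 < upper_density f z rho < +oo)%E)].
  by have [m [h [eh h0 hE]]] := fac z; exact: ftype_upper_density hE rho0.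
split; first exact: type.
(* Independence of the base point goes through the type, which does not mention z. *)
move=> z z'; have [a1 a2 a3] := type z; have [b1 b2 b3] := type z'.
split; [exact: iff_trans (iff_sym a1) b1|exact: iff_trans (iff_sym a2) b2|].
exact: iff_trans (iff_sym a3) b3.
Qed.
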